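(* Let $a_i,b_i,c_i,d_i$ ($i=1,2$) be integers such that every $2\times2$ minor of the matrix $$M=\begin{bmatrix}a_1&b_1&c_1&d_1\\ a_2&b_2&c_2&d_2\end{bmatrix}$$ is non-zero. Then the system of Diophantine equations $$a_1x^2+b_1y^2+c_1z^2=d_1,\qquad a_2x^2+b_2y^2+c_2z^2=d_2$$ has only finitely many integer solutions $(x,y,z)$. *)

(* Defs.v *)
From Stdlib Require Import ZArith List.
Open Scope Z_scope.

Definition minor2 (p1 p2 q1 q2 : Z) : Z := p1 * q2 - q1 * p2.

Definition sol (a1 b1 c1 d1 a2 b2 c2 d2 : Z) (t : Z * Z * Z) : Prop :=
  let '(x, y, z) := t in
  a1 * x^2 + b1 * y^2 + c1 * z^2 = d1 /\
  a2 * x^2 + b2 * y^2 + c2 * z^2 = d2.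

Definition finite_set (P : Z * Z * Z -> Prop) : Prop :=
  exists l : list (Z * Z * Z), forall t, P t -> In t l.

(* Main.v *)
(* Eliminating [z] and [y] and rescaling, a solution [(x, y, z)] gives an integer [X = (p m x)^2],
   with [p] and [m] fixed, such that [X - e] and [X - e'] are fixed multiples of [y^2] and [z^2],
   with [0], [e] and [e'] distinct. For two solutions, with values [X] and [Z], the three products
   [(X + a_i) (Z + a_i)], [a = (0, -e, -e')], are then perfect squares [y_i^2], and it suffices to
   show that this is impossible when [X] is large and [Z >= X^24].

   This is Thue's method with explicit simultaneous Pade approximants to the functions
   [sqrt (1 + a_i s)]. Put [g_j(x) = x^j (X + x)^(k + 1/2) / \prod_l (x - a_l)^(k + 1)] for
   [j = 0, 1, 2]. The residue of [g_j] at [a_i] is [sqrt (X + a_i) p_(i, j)], where [p_(i, j)] is,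
   after multiplication by a constant exponential in [k], an integer of size [C^k X^k].
   - As a function of [s = 1/X], the sum [\sum_i sqrt (1 + a_i s) p_(i, j) s^k] vanishes to order
     [3 k] at [0], because its derivatives at [0] are sums of all residues of a rational function
     with a zero of order at least 2 at infinity; so it is at most [C^k s^(3 k)].
   - If [\sum_i y_i p_(i, j) = 0] for [j = 0, 1, 2], then, since exact derivatives have no residue,
     the same linear relation holds between the residues of
     [f(x) (X + x)^(k + 1/2) / \prod_l (x - a_l)^(k + 1)] for all polynomials [f], hence [y = 0].
   As [y_i = sqrt (X Z) sqrt (1 + a_i / X) sqrt (1 + a_i / Z)], some nonzero integer of the form
   [c^k \sum_i y_i p_(i, j)] is at most [sqrt (X Z) C^k (X^(-2 k) + X^k / Z)] in absolute value,
   which is less than 1 when [X^(3 k) <= Z < X^(3 k + 3)]. *)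
Require Import Defs.
From Stdlib Require Import ZArith List.
Open Scope Z_scope.
From Stdlib Require Import Lia Classical.
Module Pade.

From mathcomp Require Import all_boot all_order all_algebra.
From mathcomp Require Import ring lra zify.
From mathcomp Require Import boolp classical_sets functions reals.
From mathcomp Require Import topology normedtype derive realfun exp.
From mathcomp Require Import Rstruct.
Import numFieldNormedType.Exports.
Set Implicit Arguments. Unset Strict Implicit. Unset Printing Implicit Defensive.
Import Order.TTheory GRing.Theory Num.Theory.
Local Open Scope classical_set_scope.
Local Open Scope ring_scope.

(** * The l1 norm of polynomials and local inverses with integral coefficients *)

Section Norm1.
Variable R : realFieldType.
Implicit Types (p q : {poly R}) (c : R).

Definition norm1 p := \sum_(i < size p) `|p`_i|.

Lemma norm1E n p : (size p <= n)%N -> norm1 p = \sum_(i < n) `|p`_i|.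
Proof.
move=> le_pn; rewrite /norm1 -!(big_mkord xpredT (fun i => `|p`_i|)).
rewrite [RHS](big_cat_nat (leq0n _) le_pn) /= [X in _ + X]big_nat_cond [X in _ + X]big1 ?addr0 //.
by move=> i /andP[/andP[le_pi _] _]; rewrite nth_default ?normr0.
Qed.

Lemma norm1_ge0 p : 0 <= norm1 p.
Proof. exact: sumr_ge0. Qed.

Lemma coef_norm1 p n : `|p`_n| <= norm1 p.
Proof.
have [le_pn|lt_np] := leqP (size p) n.
  by rewrite nth_default ?normr0 ?norm1_ge0.
by rewrite /norm1 (bigD1 (Ordinal lt_np)) //= lerDl sumr_ge0.
Qed.

Lemma norm1D p q : norm1 (p + q) <= norm1 p + norm1 q.
Proof.
rewrite (norm1E (size_polyD p q)) (norm1E (leq_maxl (size p) (size q))).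
rewrite (norm1E (leq_maxr (size p) (size q))) -big_split /=.
by apply: ler_sum => i _; rewrite coefD ler_normD.
Qed.

Lemma norm1Z c p : norm1 (c *: p) = `|c| * norm1 p.
Proof.
rewrite (norm1E (size_scale_leq c p)) /norm1 mulr_sumr.
by apply: eq_bigr => i _; rewrite coefZ normrM.
Qed.

Lemma norm1C c : norm1 c%:P = `|c|.
Proof. by rewrite (norm1E (size_polyC_leq1 c)) big_ord1 coefC. Qed.

Lemma norm1MX p : norm1 (p * 'X) = norm1 p.
Proof.
have le_pX : (size (p * 'X)%R <= (size p).+1)%N.
  by rewrite (leq_trans (size_polyMleq _ _)) // size_polyX addn2.
rewrite (norm1E le_pX) big_ord_recl coefMX eqxx normr0 add0r.
by apply: eq_bigr => i _; rewrite coefMX.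
Qed.

Lemma norm1M p q : norm1 (p * q) <= norm1 p * norm1 q.
Proof.
elim/poly_ind: p => [|p c IHp]; first by rewrite mul0r norm1C normr0 mul0r.
have ->: norm1 (p * 'X + c%:P) = norm1 p + `|c|.
  have le_pX : (size (p * 'X + c%:P)%R <= (size p).+1)%N.
    by rewrite size_MXaddC; case: ifP.
  rewrite (norm1E le_pX) big_ord_recl coefD coefMX coefC eqxx add0r addrC.
  by congr (_ + _); apply: eq_bigr => i _; rewrite coefD coefMX coefC addr0.
rewrite mulrDl mulrAC mul_polyC (le_trans (norm1D _ _)) // norm1MX norm1Z mulrDl.
by rewrite lerD2r.
Qed.

Lemma norm1X p n : norm1 (p ^+ n) <= norm1 p ^+ n.
Proof.
elim: n => [|n IHn]; first by rewrite !expr0 norm1C normr1.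
rewrite !exprS (le_trans (norm1M _ _)) // ler_wpM2l ?norm1_ge0 //.
Qed.

Lemma norm1_prod (I : Type) (r : seq I) (P : pred I) (F : I -> {poly R}) :
  norm1 (\prod_(i <- r | P i) F i) <= \prod_(i <- r | P i) norm1 (F i).
Proof.
elim/big_ind2: _ => [|x p y q le_px le_qy|//]; first by rewrite norm1C normr1.
by rewrite (le_trans (norm1M _ _)) // ler_pM ?norm1_ge0.
Qed.

Lemma norm1_XaddC c : norm1 ('X + c%:P) = 1 + `|c|.
Proof.
rewrite (norm1E (n := 2)) ?size_XaddC // big_ord_recl big_ord1.
by rewrite !coefD !coefX !coefC /= add0r addr0 normr1 addrC.
Qed.

End Norm1.

Section TruncatedInverse.
Variable R : realFieldType.
Implicit Types d : R.

Lemma dvdXnP n (p : {poly R}) :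
  reflect (forall i, (i < n)%N -> p`_i = 0) ('X^n %| p).
Proof.
apply: (iffP idP) => [/dvdpP[q ->] i lt_in|p0]; first by rewrite coefMXn lt_in.
apply/dvdpP; exists (drop_poly n p).
rewrite -{1}(poly_take_drop n p) -[RHS]add0r; congr (_ + _).
by apply/polyP => i; rewrite coef_take_poly coef0; case: ifP => // /p0.
Qed.

(* [invpoly d j k] is [d^(k + j + 1)] times the expansion of [(d + 'X)^-(j + 1)] to order [k]. *)
Definition invpoly d j k : {poly R} :=
  \poly_(m < k.+1) ((-1) ^+ m * 'C(j + m, m)%:R * d ^+ (k - m)).

(** Multiplying the expansion of [(d + 'X)^-(j + 2)] by [d + 'X] gives that of [(d + 'X)^-(j + 1)],
    by Pascal's rule on coefficients; the scalar [d] accounts for the two normalizations. *)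
Lemma invpolyS d j k :
  'X^(k.+1) %| invpoly d j.+1 k * ('X + d%:P) - d *: invpoly d j k.
Proof.
apply/dvdXnP => i lt_ik.
rewrite mulrDr coefB coefD coefZ coefMX coefMC !coef_poly lt_ik.
case: i lt_ik => [|i] lt_ik /=; first by rewrite !addn0 !bin0; ring.
rewrite (ltnW lt_ik) -(@subnSK i k lt_ik) !exprS !addSn !addnS !binS !natrD.
ring.
Qed.

Lemma dvdp_subM (n p q r s : {poly R}) :
  n %| p - q -> n %| r - s -> n %| p * r - q * s.
Proof.
move=> dvd_pq dvd_rs; have -> : p * r - q * s = (p - q) * r + q * (r - s) by ring.
by apply: dvdp_add; [exact: dvdp_mulr | exact: dvdp_mull].
Qed.

Lemma invpolyP d j k :
  'X^(k.+1) %| invpoly d j k * ('X + d%:P) ^+ j.+1 - (d ^+ (k + j.+1))%:P.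
Proof.
elim: j => [|j IHj].
  apply/dvdXnP => i lt_ik; rewrite expr1 addn1.
  rewrite mulrDr coefB coefD coefC coefMX coefMC !coef_poly lt_ik.
  case: i lt_ik => [|i] lt_ik /=; first by rewrite bin0 subn0 exprSr; ring.
  by rewrite (ltnW lt_ik) !add0n !binn -(@subnSK i k lt_ik) !exprS; ring.
rewrite [('X + _) ^+ _.+2]exprS mulrA.
have -> : (d ^+ (k + j.+2))%:P = d%:P * (d ^+ (k + j.+1))%:P.
  by rewrite -polyCM -exprS -addnS.
have := dvdp_mulr (('X + d%:P) ^+ j.+1) (invpolyS d j k).
rewrite mulrBl -mul_polyC => dvdS; have := dvdp_mull d%:P IHj; rewrite mulrBr mulrA => dvdI.
by have := dvdp_add dvdS dvdI; rewrite addrA subrK.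
 Qed.

Lemma leq_bin_exp2 n m : ('C(n, m) <= 2 ^ n)%N.
Proof.
elim: n m => [|n IHn] [|m] //; first by rewrite bin0 expn_gt0.
by rewrite binS expnS mul2n -addnn leq_add.
Qed.

Lemma norm1_invpoly d k : 1 <= `|d| -> norm1 (invpoly d k k) <= (8 * `|d|) ^+ k.
Proof.
move=> d_ge1; rewrite (norm1E (size_poly _ _)).
have le_i (i : 'I_k.+1) : `|(invpoly d k k)`_i| <= (4 * `|d|) ^+ k.
  rewrite coef_poly ltn_ord !normrM normrX normrN1 expr1n mul1r normr_nat normrX exprMn.
  apply: ler_pM; [by []|by rewrite exprn_ge0| |by apply: ler_weXn2l; rewrite ?leq_subr].
  rewrite -natrX ler_nat.
  rewrite (leq_trans (leq_bin_exp2 _ _)) // -[4%N]/(2 ^ 2)%N -expnM leq_exp2l //.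
  by rewrite mul2n -addnn leq_add2l -ltnS.
rewrite (le_trans (ler_sum _ (fun i _ => le_i i))) // sumr_const card_ord.
have -> : 8 * `|d| = 2 * (4 * `|d|) by ring.
rewrite [leRHS]exprMn -[_ *+ k.+1]mulr_natl ler_wpM2r ?exprn_ge0 ?mulr_ge0 //.
by rewrite -natrX ler_nat ltn_expl.
Qed.

End TruncatedInverse.

Section LocalInverse.
Variables (R : archiRealFieldType) (I : finType) (a : I -> R).
Hypotheses (a_int : forall i, a i \is a Num.int) (a_inj : injective a).

(** The product of [x - a l] over the other nodes, in the local coordinate ['X = x - a i];
    [cofac0 i] is its value at the node. *)
Definition cofac i : {poly R} := \prod_(l | l != i) ('X + (a i - a l)%:P).
Definition cofac0 i : R := \prod_(l | l != i) (a i - a l).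

(* The scalar keeps the coefficients integral and makes [locinv_lead] independent of [i]. *)
Definition locinv k i : {poly R} :=
  (\prod_(j | j != i) cofac0 j) ^+ k.*2.+1 *: \prod_(l | l != i) invpoly (a i - a l) k k.
Definition locinv_lead k : R := (\prod_j cofac0 j) ^+ k.*2.+1.

Lemma diff_neq0 i l : l != i -> a i - a l != 0.
Proof. by apply: contraNneq => /eqP; rewrite subr_eq0 => /eqP/a_inj ->. Qed.

Lemma cofac0_neq0 i : cofac0 i != 0.
Proof. by apply/prodf_neq0 => l; exact: diff_neq0. Qed.

Lemma locinv_lead_neq0 k : locinv_lead k != 0.
Proof. by rewrite expf_neq0 //; apply/prodf_neq0 => i _; exact: cofac0_neq0. Qed.

Lemma cofac_horner0 i : (cofac i).[0] = cofac0 i.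
Proof. by rewrite horner_prod; apply: eq_bigr => l _; rewrite !hornerE. Qed.

(** By [invpolyP] with [j = k], each other node contributes [(a i - a l) ^+ k.*2.+1]. These factors
    form a power of [cofac0 i], which the scalar in [locinv] completes to a product over all
    nodes. *)
Lemma locinvP k i :
  'X^(k.+1) %| locinv k i * cofac i ^+ k.+1 - (locinv_lead k)%:P.
Proof.
have -> : locinv_lead k =
    (\prod_(j | j != i) cofac0 j) ^+ k.*2.+1 * \prod_(l | l != i) (a i - a l) ^+ k.*2.+1.
  by rewrite prodrXl -exprMn /locinv_lead (bigD1 i) //= mulrC.
rewrite polyCM -scalerAl -mul_polyC -mulrBr dvdp_mull // /cofac -prodrXl -big_split /=.
rewrite rmorph_prod /=.
elim/big_rec2: _ => [|l p q _ IH]; first by rewrite subrr dvdp0.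
apply: dvdp_subM => //.
by have := invpolyP (a i - a l) k k; rewrite addnS addnn.
Qed.

Lemma diff_norm_ge1 i l : l != i -> 1 <= `|a i - a l|.
Proof. by move=> ne_li; rewrite norm_intr_ge1 ?rpredB ?diff_neq0. Qed.

Lemma locinv_over k i : locinv k i \is a polyOver Num.int.
Proof.
rewrite polyOverZ ?rpredX ?rpred_prod // => [j _|l _].
  by apply: rpred_prod => l _; rewrite rpredB.
apply/polyOver_poly => m _; rewrite !rpredM ?rpredX ?rpredN ?rpred1 ?rpred_nat //.
by rewrite rpredB.
Qed.

(** Distinct integral nodes differ by at least 1 in absolute value, so exponents may be raised, and
    the product over [i] gives one constant for all nodes. *)
Lemma norm1_locinv : exists2 C : R, 1 <= C & forall k i, norm1 (locinv k i) <= C ^+ k.+1.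
Proof.
pose E i := \prod_(j | j != i) cofac0 j.
pose F i := \prod_(l | l != i) (8 * `|a i - a l|).
have E_ge1 i : 1 <= `|E i|.
  rewrite norm_intr_ge1 //; last by apply/prodf_neq0 => j _; exact: cofac0_neq0.
  by do 2![apply: rpred_prod => ? _]; rewrite rpredB.
have F_ge1 i : 1 <= F i.
  rewrite /F; elim/big_rec: _ => // l x ne_li x_ge1.
  by have d_ge1 := diff_norm_ge1 ne_li; rewrite mulr_ege1 // mulr_ege1 // ler1n.
(* The square suffices because [k.*2.+1 <= 2 * k.+1]. *)
pose C i := `|E i| ^+ 2 * F i.
have C_ge1 i : 1 <= C i by rewrite /C mulr_ege1 ?exprn_ege1.
exists (\prod_i C i); first by rewrite -[1]/1; elim/big_rec: _ => // i x _ x1; rewrite mulr_ege1.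
move=> k i; apply: (@le_trans _ _ (C i ^+ k.+1)); last first.
  rewrite lerXn2r ?nnegrE ?(le_trans ler01) //.
    by elim/big_rec: _ => // j x _ x1; rewrite mulr_ege1.
  rewrite (bigD1 i) //= ler_peMr ?(le_trans ler01) //.
  by elim/big_rec: _ => // j x _ x1; rewrite mulr_ege1.
rewrite norm1Z normrX /C exprMn -exprM; apply: ler_pM; rewrite ?exprn_ge0 ?norm1_ge0 //.
  by apply: ler_weXn2l; [exact: E_ge1 | lia].
apply: le_trans (norm1_prod _ _ _) _.
apply: (@le_trans _ _ (F i ^+ k)); last by apply: ler_weXn2l.
rewrite -prodrXl; apply: ler_prod => l ne_li; rewrite norm1_ge0 /=.
exact/norm1_invpoly/diff_norm_ge1.
Qed.

End LocalInverse.

(** * Residues of the Pade forms and their nonvanishing *)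

Section GeneralizedBinomial.
Variable R : realFieldType.
Implicit Types r : R.

Definition gbin r h : R := (\prod_(j < h) (r - j%:R)) / h`!%:R.

Lemma gbin0 r : gbin r 0 = 1.
Proof. by rewrite /gbin big_ord0 fact0 divr1. Qed.

Lemma gbinS r h : (h.+1)%:R * gbin r h.+1 = (r - h%:R) * gbin r h.
Proof.
rewrite /gbin big_ord_recr /= factS natrM invfM.
by rewrite mulrCA mulVKf ?pnatr_eq0 //; ring.

Qed.

Lemma gbin_pred r h : r * gbin (r - 1) h = h.+1%:R * gbin r h.+1.
Proof.
rewrite /gbin big_ord_recl subr0 factS natrM.
have -> : \prod_(i < h) (r - (lift ord0 i)%:R) = \prod_(i < h) (r - 1 - i%:R).
  by apply: eq_bigr => i _; rewrite /= /bump add1n -natr1 opprD addrA addrAC.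
by field; rewrite nat1r !pnatr_eq0 -lt0n fact_gt0.
Qed.

Lemma gbinD1 r h : gbin (r + 1) h.+1 = gbin r h.+1 + gbin r h.
Proof.
have h0 : (h.+1%:R : R) != 0 by rewrite pnatr_eq0.
apply: (mulfI h0); rewrite -gbin_pred addrK mulrDr gbinS -natr1; ring.
Qed.

(** The ratio [|r - h| / (h + 1)] of consecutive coefficients is at most [(m + h + 1) / (h + 1)],
    the corresponding ratio on the right. *)
Lemma gbin_bound r m h : `|r| <= m.+1%:R -> `|gbin r h| <= 'C(m + h, h)%:R.
Proof.
move=> le_rm; elim: h => [|h IHh]; first by rewrite gbin0 bin0 normr1.
have h0 : (0 : R) < h.+1%:R by rewrite ltr0n.
have E : h.+1%:R * `|gbin r h.+1| = `|r - h%:R| * `|gbin r h|.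
  by rewrite -{1}(gtr0_norm h0) -normrM gbinS normrM.
rewrite -(ler_pM2l h0) E addnS -natrM -mul_bin_diag natrM ler_pM //.
rewrite (le_trans (ler_normB _ _)) // normr_nat -addSn natrD lerD2r.
exact: le_rm.
Qed.

End GeneralizedBinomial.

Section HalfIntegerBinomial.
Variable R : archiRealFieldType.

(** Both sides are multiplied by [- 2 (2 h + 1) / (h + 1)] when [h] increases by 1. *)
Lemma gbin_opp_half h : 4 ^+ h * gbin (- 2^-1 : R) h = (-1) ^+ h * 'C(h.*2, h)%:R.
Proof.
elim: h => [|h IHh]; first by rewrite gbin0 bin0 !expr0.
have h0 : (h.+1%:R : R) != 0 by rewrite pnatr_eq0.
apply: (mulfI h0); rewrite mulrCA gbinS.
have E : (h.+1 * 'C(h.+1.*2, h.+1) = 2 * h.*2.+1 * 'C(h.*2, h))%N.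
  rewrite doubleS -mul_bin_diag /= -bin_sub; last by lia.
  have -> : (h.*2.+1 - h = h.+1)%N by lia.
  have -> : (h.*2.+2 = 2 * h.+1)%N by lia.
  by rewrite -!mulnA -mul_bin_diag.
transitivity (- (2 * h.*2.+1)%:R * (4 ^+ h * gbin (- 2^-1 : R) h)).
  by rewrite exprS natrM -[h.*2.+1%:R]natr1 -muln2 natrM; field.
by rewrite IHh [RHS]mulrCA -natrM E natrM exprS; ring.
Qed.

(** Pascal's rule carries integrality from [- 2^-1] to [j - 2^-1]. Hence [4 ^+ k] clears the
    denominators in [halfpow]. *)
Lemma gbin_half_int j h : 4 ^+ h * gbin (j%:R - 2^-1 : R) h \is a Num.int.
Proof.
elim: j h => [|j IHj] h.
  by rewrite add0r gbin_opp_half rpredM ?rpredX ?rpredN ?rpred1 ?rpred_nat.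
case: h => [|h]; first by rewrite gbin0 mulr1 rpred1.
have -> : j.+1%:R - 2^-1 = j%:R - 2^-1 + 1 :> R by rewrite -natr1; ring.
rewrite gbinD1 mulrDr; apply: rpredD; first exact: IHj.
by rewrite exprS -mulrA rpredM ?rpred_nat ?IHj.
Qed.

End HalfIntegerBinomial.


Section Pade.
Variable R : archiRealFieldType.
Implicit Types (p q f g V S : {poly R}) (k : nat) (w : R).

(* Expansion of [w^(-1/2) (w + 'X)^(k + 1/2)] to order [k]. *)
Definition halfpow k w : {poly R} := \poly_(h < k.+1) (gbin (k%:R + 2^-1) h * w ^+ (k - h)).

(** The function [f = (w + x)^(k + 1/2)] satisfies [(w + x) f' = (k + 1/2) f]; truncating it after
    degree [k] is felt only from degree [k] on. *)
Lemma halfpow_ode k w :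
  'X^k %| ('X + w%:P) * (halfpow k w)^`() - (k%:R + 2^-1) *: halfpow k w.
Proof.
apply/dvdXnP => i lt_ik; rewrite mulrDl coefB coefD coefZ coefXM coefCM !coef_deriv !coef_poly.
have gS j : (j < k)%N -> gbin (k%:R + 2^-1) j.+1 * w ^+ (k - j.+1) *+ j.+1 * w =
    (k%:R + 2^-1 - j%:R) * gbin (k%:R + 2^-1) j * w ^+ (k - j).
  by move=> lt_jk; rewrite -gbinS -[_ *+ _]mulr_natl -(subnSK lt_jk) exprSr; ring.
case: i lt_ik => [|i] lt_ik; rewrite /= ?(ltnS _ k) ?lt_ik ?(ltnW lt_ik).
  by rewrite mulrC gS // subn0; ring.
by rewrite [w * _]mulrC gS // -[_ *+ i.+1]mulr_natl; ring.
Qed.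

(** The polynomial is ['X^(k + 1)] times the derivative of [p / 'X^k], and a derivative has no
    residue. *)
Lemma coef_log_deriv k p : ('X * p^`() - k%:R *: p)`_k = 0.
Proof.
rewrite coefB coefZ coefXM; case: k => [|k]; first by rewrite mul0r subr0.
by rewrite coef_deriv mulr_natl subrr.
Qed.

(* With [Z = S q f (X + w) V] the polynomial below is congruent to [X Z' - k Z] modulo [X^(k+1)]. *)
Lemma local_exactness k w c S q V :
    q.[0] != 0 -> 'X^(k.+1) %| S * q ^+ k.+1 - c%:P ->
  (halfpow k w * (((k%:R + 3 / 2) *: (V * ('X * q)) +
     ('X + w%:P) * (V^`() * ('X * q) - k%:R *: (V * (q + 'X * q^`())))) * S))`_k = 0.
Proof.
move=> q0 /dvdpP[e Se].
(* Differentiating the congruence for [S] gives this one multiplied by [q ^+ k], which cancels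
   because [q] does not vanish at 0. *)
have dvdS : 'X^k %| S^`() * q + k.+1%:R *: (S * q^`()).
  rewrite -(@Gauss_dvdpr _ _ (q ^+ k)); last first.
    rewrite coprimep_expl // coprimep_expr //.
    by rewrite coprimep_sym -['X]subr0 -polyC0 coprimep_XsubC rootE.
  have /(congr1 (fun p : {poly R} => p^`())) := Se.
  rewrite derivB derivC subr0 !derivM deriv_exp derivXn /= => eq_d.
  have -> : q ^+ k * (S^`() * q + k.+1%:R *: (S * q^`())) =
            (e^`() * 'X + e *+ k.+1) * 'X^k.
    rewrite mulrDl -mulrA -exprS -[e *+ _]mulr_natl.
    rewrite -mul_polyC polyC_natr.
    transitivity (S^`() * q ^+ k.+1 + S * (q^`() * q ^+ k *+ k.+1)).
      by rewrite -[_ *+ k.+1]mulr_natl exprS; ring.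
    by rewrite eq_d -[_ *+ k.+1]mulr_natl; ring.
  exact: dvdp_mull.
have /dvdpP[e1 Se1] := dvdS.
have /dvdpP[e2 fe2] := halfpow_ode k w.
set f := halfpow k w in fe2 *.
(* Here [S * q] stands for a multiple of [q^(-k)], so [Z / 'X^k] stands for a multiple of
   [(w + x)^(k + 3/2) V / ('X q)^k]. *)
pose Z := S * q * f * ('X + w%:P) * V.
have := coef_log_deriv k Z.
(* The errors [e1] and [e2], of order [k], come with a further factor ['X] and do not reach the
   coefficient of ['X^k]. *)
have -> : 'X * Z^`() - k%:R *: Z =
  f * (((k%:R + 3 / 2) *: (V * ('X * q)) +
     ('X + w%:P) * (V^`() * ('X * q) - k%:R *: (V * (q + 'X * q^`())))) * S)
   + 'X^k * 'X * (e1 * f * ('X + w%:P) * V + e2 * S * q * V).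
  rewrite /Z !derivM derivD derivX derivC.
  transitivity (f * (((k%:R + 3 / 2) *: (V * ('X * q)) +
     ('X + w%:P) * (V^`() * ('X * q) - k%:R *: (V * (q + 'X * q^`())))) * S) +
     'X * ((e1 * 'X^k) * (f * ('X + w%:P) * V) + (e2 * 'X^k) * (S * q * V))); last by ring.
  have -> : 3 / 2 = 1 + 2^-1 :> R by field.
  rewrite -Se1 -fe2 -!mul_polyC -natr1 !polyCD polyC1; ring.
by rewrite coefD -exprSr coefXnM ltnSn addr0.
Qed.

Lemma monic_coef n (P : {poly R}) : P \is monic -> size P = n.+1 ->
  P`_n = 1 /\ forall m, (n < m)%N -> P`_m = 0.
Proof.
move=> /monicP; rewrite lead_coefE => lead sP; rewrite sP /= in lead; split=> // m lt_nm.
by rewrite nth_default // sP.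
Qed.

(* [(w + x)^(k + 1/2) Dpoly W / P^(k + 1)] is the derivative of [(w + x)^(k + 3/2) W / P^k]. *)
Definition Dpoly k w (P W : {poly R}) :=
  (k%:R + 3 / 2) *: (W * P) + ('X + w%:P) * (W^`() * P - k%:R *: (W * P^`())).

(** In degree [d + n + 1] only leading monomials matter: [W P] contributes [k + 3/2], the terms with
    derivatives [d - k (n + 1)]. *)
Lemma coef_DpolyXn k w P n d m : P \is monic -> size P = n.+2 -> (d + n.+1 <= m)%N ->
  (Dpoly k w P 'X^d)`_m =
    (k%:R + 3 / 2 + (d%:R - k%:R * n.+1%:R)) *+ (m == d + n.+1)%N.
Proof.
move=> monP sP le_m; have [Pn P0] := monic_coef monP sP; rewrite /Dpoly.
have -> : ('X^d)^`() * P - k%:R *: ('X^d * P^`()) =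
          ('X^d * P)^`() - k.+1%:R *: ('X^d * P^`()).
  by rewrite derivM -!mul_polyC -natr1 polyCD polyC1; ring.
case: m le_m => [|m]; rewrite addnS // ltnS => le_m.
have lt_md : (m < d)%N = false by apply/negbTE; rewrite -leqNgt; lia.
have lt_md1 : (m.+1 < d)%N = false by apply/negbTE; rewrite -leqNgt; lia.
rewrite [('X + _) * _]mulrDl !coefD coefZ coefXM coefCM /= !coefB !coefZ !coef_deriv !coefXnM.
rewrite !lt_md lt_md1 ltnNge (leq_trans _ (leqnSn _)) ?leqW //=; last by lia.
rewrite !coef_deriv.
have -> : (m.+2 - d = (m - d).+2)%N by lia.
have -> : (m.+1 - d = (m - d).+1)%N by lia.
rewrite [P`_(m - d).+2]P0 ?mul0rn; last by lia.
rewrite eqSS; have [->|ne_m] := eqVneq m (d + n)%N.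
  rewrite addKn Pn mulr1n; ring.
rewrite P0 ?mul0rn; last by lia.
by rewrite !(mulr0, subr0, addr0, mul0rn).
Qed.

Lemma half_int_neq0 (i j : nat) : i%:R + 2^-1 != j%:R :> R.
Proof.
apply/eqP => E; have /eqP : (2 * i + 1)%:R = (2 * j)%:R :> R by rewrite natrD !natrM -E; field.
by rewrite eqr_nat; lia.
Qed.

(** The leading coefficient of [Dpoly k w P 'X^d] is a half-integer, hence nonzero, so these
    polynomials have all the degrees above [n]. Together with [1, 'X, ..., 'X^n] they span all
    polynomials, by descent on the degree. *)
Lemma Dpoly_annihilates k w P n (Psi : {poly R} -> R) :
  P \is monic -> size P = n.+2 ->
  (forall c p q, Psi (c *: p + q) = c * Psi p + Psi q) ->
  (forall d, Psi (Dpoly k w P 'X^d) = 0) -> (forall j, (j <= n)%N -> Psi 'X^j = 0) ->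
  forall p, Psi p = 0.
Proof.
move=> monP sP linPsi PsiD Psi0.
have PsiZ : Psi 0 = 0 by have := linPsi (-1) 0 0; rewrite scaler0 addr0 mulN1r addNr.
have PsiS c p : Psi p = 0 -> Psi (c *: p) = 0.
  by move=> p0; have := linPsi c p 0; rewrite addr0 p0 PsiZ mulr0 addr0.
suff Psi_size m p : (size p <= m)%N -> Psi p = 0 by move=> p; apply: Psi_size.
elim: m p => [|m IHm] p le_pm.
  by have /eqP -> : p == 0 by rewrite -size_poly_leq0.
suff [q [c [sq Psiq c0 qm]]] : exists q c, [/\ (size q <= m.+1)%N, Psi q = 0, c != 0 & q`_m = c].
  have -> : p = (p`_m / c) *: q + (p - (p`_m / c) *: q) by rewrite addrC subrK.
  rewrite linPsi Psiq mulr0 add0r; apply: IHm.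
  apply/leq_sizeP => j; rewrite leq_eqVlt => /predU1P[<-|lt_mj].
    by rewrite coefB coefZ qm divfK ?subrr.
  rewrite coefB coefZ [q`_j]nth_default ?(leq_trans sq) // nth_default ?mulr0 ?subr0 //.
  exact: leq_trans le_pm lt_mj.
have [le_mn|lt_nm] := leqP m n.
  by exists 'X^m, 1; rewrite size_polyXn coefXn eqxx oner_neq0 Psi0.
have Em : (m - n.+1 + n.+1 = m)%N by rewrite subnK.
set d := (m - n.+1)%N in Em.
have coefD := @coef_DpolyXn k w P n d _ monP sP; rewrite Em in coefD.
exists (Dpoly k w P 'X^d), (k%:R + 3 / 2 + (d%:R - k%:R * n.+1%:R)).
split=> //; last by rewrite coefD // eqxx.
  by apply/leq_sizeP => j lt_mj; rewrite coefD 1?ltnW // gtn_eqF.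
have -> : k%:R + 3 / 2 + (d%:R - k%:R * n.+1%:R) =
    (k + d + 1)%:R + 2^-1 - (k * n.+1)%:R :> R by rewrite !natrD natrM; field.
by rewrite subr_eq0 half_int_neq0.
Qed.
End Pade.

Section Nonvanishing.
Variables (R : archiRealFieldType) (I : finType) (a : I -> R).
Hypotheses (a_inj : injective a).

(* Residue at [a i] of [g(x) (X + x)^(k + 1/2) / \prod_l (x - a l)^(k + 1)], divided by
   [(X + a i)^(1/2)] and multiplied by [locinv_lead a k]. *)
Definition padeform k X i (g : {poly R}) : R :=
  (halfpow k (X + a i) * ((g \Po ('X + (a i)%:P)) * locinv a k i))`_k.

Definition nodal : {poly R} := \prod_l ('X - (a l)%:P).

Lemma XsubC_shift (c d : R) : ('X - c%:P) \Po ('X + d%:P) = 'X + (d - c)%:P.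
Proof. by rewrite comp_polyB comp_polyX comp_polyC polyCB addrA. Qed.

Lemma nodal_shift i : nodal \Po ('X + (a i)%:P) = 'X * cofac a i.
Proof.
rewrite /nodal (bigD1 i) //= comp_polyM XsubC_shift subrr addr0; congr (_ * _).
by rewrite rmorph_prod; apply: eq_bigr => l _; rewrite /= XsubC_shift.
Qed.

Lemma Dpoly_shift k X (P W : {poly R}) c :
  Dpoly k X P W \Po ('X + c%:P) =
  Dpoly k (X + c) (P \Po ('X + c%:P)) (W \Po ('X + c%:P)).
Proof.
rewrite /Dpoly !deriv_comp derivD derivX derivC addr0 !mulr1.
rewrite comp_polyD !comp_polyM comp_polyB !comp_polyZ !comp_polyM comp_polyD comp_polyX comp_polyC.
by rewrite polyCD addrAC addrA.
Qed.

Lemma padeform_Dpoly k X i (W : {poly R}) : padeform k X i (Dpoly k X nodal W) = 0.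
Proof.
rewrite /padeform Dpoly_shift nodal_shift /Dpoly derivM derivX mul1r.
by apply: local_exactness (locinvP a k i); rewrite cofac_horner0 cofac0_neq0.
Qed.

Lemma padeform_linear k X i c (p q : {poly R}) :
  padeform k X i (c *: p + q) = c * padeform k X i p + padeform k X i q.
Proof.
by rewrite /padeform comp_polyD comp_polyZ mulrDl mulrDr coefD -scalerAl -scalerAr coefZ.
Qed.

(** A relation that holds for the monomials of degree below the number of nodes, and trivially for
    exact derivatives, holds for all polynomials; a test polynomial then isolates each [Y i]. *)
Lemma pade_nonvanishing k X (Y : I -> R) : (forall i, X + a i != 0) ->
  (forall j, (j < #|I|)%N -> \sum_i Y i * padeform k X i 'X^j = 0) ->
  forall i, Y i = 0.
Proof.
move=> w_neq0 Y0 i.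
have cardI : #|I| = #|I|.-1.+1 by rewrite prednK //; apply/card_gt0P; exists i.
have nodal_monic : nodal \is monic by apply: monic_prod => l _; exact: monicXsubC.
have size_nodal : size nodal = #|I|.-1.+2.
  by rewrite -cardI size_prod_XsubC -sum1_size sum1_card.
have := Dpoly_annihilates (k := k) (w := X) nodal_monic size_nodal.
move=> /(_ (fun g => \sum_i Y i * padeform k X i g)).
(* This [g] cancels the pole at every other node and leaves a simple pole at [a i], where the form
   equals [(X + a i)^k] times [locinv_lead a k]. *)
set g := (\prod_(l | l != i) ('X - (a l)%:P)) ^+ k.+1 * ('X - (a i)%:P) ^+ k.
move=> ann; have : \sum_i Y i * padeform k X i g = 0.
  apply: ann => [c p q|d|j le_j]; last by apply: Y0; rewrite cardI ltnS.
    rewrite mulr_sumr -big_split; apply: eq_bigr => l _ /=.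
    by rewrite padeform_linear; ring.
  by apply: big1 => l _; rewrite padeform_Dpoly mulr0.
rewrite (bigD1 i) //= big1 ?addr0 => [|l ne_li].
  rewrite /padeform comp_polyM !rmorphXn /= XsubC_shift subrr addr0 rmorph_prod /=.
  under eq_bigr do rewrite XsubC_shift.
  rewrite -/(cofac a i).
  have /dvdpP[e] := locinvP a k i; set c := (locinv_lead a k)%:P => /(canRL (subrK _)) E.
  have -> : halfpow k (X + a i) * (cofac a i ^+ k.+1 * 'X^k * locinv a k i) =
            halfpow k (X + a i) * (e * 'X^(k.+1) + c) * 'X^k by rewrite -E; ring.
  rewrite coefMXn ltnn subnn -horner_coef0 !hornerE expr0n mulr0 add0r /c.
  rewrite horner_coef0 coef_poly /= gbin0 mul1r subn0.
  by move=> /eqP; rewrite !mulf_eq0 expf_eq0 (negbTE (w_neq0 i)) andbF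
    (negbTE (locinv_lead_neq0 a_inj k)) !orbF => /eqP.
rewrite /padeform /g (bigD1 l) //= exprMn !comp_polyM rmorphXn /= XsubC_shift subrr addr0.
by rewrite -!mulrA mulrCA coefXnM ltnSn mulr0.
Qed.

End Nonvanishing.

(** * Vanishing of the sum of residues *)

Section ResidueTheorem.
Variables (R : archiRealFieldType) (I : finType) (a : I -> R).
Hypotheses (a_inj : injective a).

Lemma dvdp_XsubC_shift n c (p : {poly R}) :
  'X^n %| p \Po ('X + c%:P) -> ('X - c%:P) ^+ n %| p.
Proof.
move=> /dvdpP[q pE]; apply/dvdpP; exists (q \Po ('X - c%:P)).
rewrite -{1}[p](comp_polyXaddC_K _ c) pE comp_polyM; congr (_ * _).
by rewrite rmorphXn /= comp_polyX.
Qed.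

Lemma dvdp_nodalX n (p : {poly R}) :
  (forall i, 'X^n %| p \Po ('X + (a i)%:P)) -> nodal a ^+ n %| p.
Proof.
move=> dvd_p; rewrite /nodal -prodrXl.
elim: (index_enum I) (index_enum_uniq I) => [|i r IHr] /=.
  by rewrite big_nil dvd1p.
move=> /andP[r'i /IHr dvd_r]; rewrite big_cons Gauss_dvdp ?dvdp_XsubC_shift //.
elim: r r'i {IHr dvd_r} => [|l r IHr]; first by rewrite big_nil coprimep1.
rewrite inE negb_or big_cons coprimepMr => /andP[ne_il /IHr ->]; rewrite andbT.
by rewrite coprimep_expl // coprimep_expr // coprimep_XsubC root_XsubC (inj_eq a_inj) eq_sym.
Qed.

Lemma coefM_top m n (p q : {poly R}) : (size p <= m.+1)%N -> (size q <= n.+1)%N ->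
  (p * q)`_(m + n) = p`_m * q`_n.
Proof.
move=> sp sq; have lt_m : (m < (m + n).+1)%N by lia.
rewrite coefM (bigD1 (Ordinal lt_m)) //= addKn big1 ?addr0 // => i ne_im.
have {ne_im} ne_im : i != m :> nat by apply: contraNneq ne_im => im; apply/eqP/val_inj.
have [lt_im|le_mi] := ltnP i m.
  by rewrite [q`__]nth_default ?mulr0 // (leq_trans sq) //; lia.
by rewrite nth_default ?mul0r // (leq_trans sp) //; lia.
Qed.

Lemma coef_comp_XaddC m c (p : {poly R}) : (size p <= m.+1)%N ->
  (p \Po ('X + c%:P))`_m = p`_m.
Proof.
elim/poly_ind: p m => [|p b IHp] m sp; first by rewrite comp_poly0 !coef0.
rewrite comp_polyD comp_polyM comp_polyX comp_polyC mulrDr !coefD !coefC coefMX coefMC.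
have {}sp : (size p <= m)%N.
  by move: sp; rewrite size_MXaddC; case: ifP => // /andP[/eqP-> _]; rewrite size_poly0.
have spc : size (p \Po ('X + c%:P)) = size p by rewrite size_comp_poly2 // size_XaddC.
rewrite [(_ \Po _)`_m]nth_default ?spc // mul0r addr0 coefMX.
by case: m sp => //= m sp; rewrite IHp.
Qed.

(** The size bound says that [g / nodal^(k + 1)] vanishes to order at least 2 at infinity. The
    residues are read off from its partial fraction decomposition. *)
Lemma sum_residues k (g : {poly R}) : (size g < #|I| * k.+1)%N ->
  \sum_i ((g \Po ('X + (a i)%:P)) * locinv a k i)`_k = 0.
Proof.
move=> sg; set V := fun i => (g \Po ('X + (a i)%:P)) * locinv a k i.
pose N i : {poly R} := \prod_(l | l != i) ('X - (a l)%:P) ^+ k.+1.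
(* [T i / 'X^(k + 1)] is the principal part at [a i], up to the factor [locinv_lead a k], and [U] is
   the numerator of the sum of all principal parts. *)
pose T i := take_poly k.+1 (V i).
pose U := \sum_i (T i \Po ('X - (a i)%:P)) * N i.
have cardI (i : I) : (#|I| * k.+1 = k + (#|I|.-1 * k.+1).+1)%N.
  have: (0 < #|I|)%N by apply/card_gt0P; exists i.
  by case: #|I| => // m _; rewrite mulSn /= addSn addnS.
have sN i : size (N i) = (#|I|.-1 * k.+1).+1.
  rewrite /N size_prod => [|l _]; last by rewrite expf_neq0 ?polyXsubC_eq0.
  under eq_bigr do rewrite size_exp_XsubC.
  by rewrite sum_nat_const cardC1 mulnS subSn ?leq_addr // addKn.
have NE i : (N i)`_(#|I|.-1 * k.+1) = 1.
  have /monicP : N i \is monic by apply: monic_prod => l _; rewrite monic_exp ?monicXsubC.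
  by rewrite lead_coefE sN.
have sT i : (size (T i) <= k.+1)%N := size_take_poly _ _.
have sTc i : (size (T i \Po ('X - (a i)%:P)) <= k.+1)%N.
  by rewrite size_comp_poly2 ?size_XsubC.
(* The two sides agree to order [k + 1] at every node, so their difference is divisible by
   [nodal a ^+ k.+1], whose degree is too large unless the difference is zero. *)
have UE : U = locinv_lead a k *: g.
  apply/eqP; rewrite -subr_eq0; apply: contraTT isT => D_neq0.
  have /(dvdp_leq D_neq0) : nodal a ^+ k.+1 %| U - locinv_lead a k *: g.
    apply: dvdp_nodalX => i; rewrite comp_polyB comp_polyZ /U rmorph_sum (bigD1 i) //=.
    rewrite comp_polyM.
    have -> : (T i \Po ('X - (a i)%:P)) \Po ('X + (a i)%:P) = T i.
      by have := comp_polyXaddC_K (T i) (- a i); rewrite polyCN opprK.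
    have -> : N i \Po ('X + (a i)%:P) = cofac a i ^+ k.+1.
      rewrite rmorph_prod /cofac -prodrXl; apply: eq_bigr => l _.
      by rewrite rmorphXn /= XsubC_shift.
    rewrite addrAC; apply: dvdp_add; last first.
      apply: (big_ind (fun p => 'X^(k.+1) %| p)) => [|p q dvdp_p dvdp_q|l ne_li].
      - exact: dvdp0.
      - exact: dvdp_add.
      rewrite comp_polyM dvdp_mull // /N (bigD1 i) 1?eq_sym //= comp_polyM dvdp_mulr //.
      by rewrite rmorphXn /= XsubC_shift subrr addr0.
    have -> : T i * cofac a i ^+ k.+1 - locinv_lead a k *: (g \Po ('X + (a i)%:P)) =
        (g \Po ('X + (a i)%:P)) * (locinv a k i * cofac a i ^+ k.+1 - (locinv_lead a k)%:P)
        - drop_poly k.+1 (V i) * cofac a i ^+ k.+1 * 'X^(k.+1).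
      have := poly_take_drop k.+1 (V i); rewrite -/(T i) => /(canRL (addrK _)) ->.
      by rewrite -mul_polyC /V; ring.
    by rewrite dvdp_sub ?dvdp_mulIr // dvdp_mull // locinvP.
  rewrite leqNgt => /negP[].
  have -> : size (nodal a ^+ k.+1) = (#|I| * k.+1).+1.
    rewrite /nodal -prodrXl size_prod => [|l _]; last by rewrite expf_neq0 ?polyXsubC_eq0.
    under eq_bigr do rewrite size_exp_XsubC.
    by rewrite sum_nat_const mulnS subSn ?leq_addr // addKn.
  rewrite ltnS (leq_trans (size_polyD _ _)) // geq_max size_polyN.
  rewrite (leq_trans (size_scale_leq _ _) (ltnW sg)) andbT.
  apply: leq_trans (size_sum _ _ _) _; apply/bigmax_leqP => i _.
  rewrite (leq_trans (size_polyMleq _ _)) // sN addnS /= (cardI i) addnS -addSn leq_add2r.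
  exact: sTc.
have [i _|I0] := pickP I; last by apply: big1 => i _; have := I0 i.
(* This degree is [#|I| * k.+1 - 1], beyond that of [g]. As [N i] is monic, the coefficient of [U]
   there is the sum of the residues. *)
have : U`_(k + #|I|.-1 * k.+1) = 0.
  by rewrite UE coefZ nth_default ?mulr0 // -ltnS -addnS -cardI.
rewrite /U coef_sum => U0; rewrite -[RHS]U0; apply: eq_bigr => l _.
rewrite coefM_top ?sN // NE mulr1 -polyCN coef_comp_XaddC //.
by rewrite coef_take_poly ltnSn.
Qed.

End ResidueTheorem.

(** * Size of the Pade forms *)

Section PadeformSize.
Variables (R : archiRealFieldType) (I : finType) (a : I -> R).
Hypotheses (a_int : forall i, a i \is a Num.int) (a_inj : injective a).

Lemma padeform_int k X i e : X \is a Num.int ->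
  4 ^+ k * padeform a k X i 'X^e \is a Num.int.
Proof.
move=> X_int; rewrite /padeform comp_Xn_poly coefM mulr_sumr; apply: rpred_sum => h _.
rewrite mulrA; apply: rpredM; last first.
  apply/polyOverP; rewrite rpredM ?locinv_over // rpredX // rpredD ?polyOverX //.
  by rewrite polyOverC.
rewrite coef_poly ltn_ord mulrA rpredM ?rpredX ?rpredD //.
have -> : 4 ^+ k = 4 ^+ (k - h) * 4 ^+ h :> R by rewrite -exprD subnK // -ltnS.
have -> : k%:R + 2^-1 = k.+1%:R - 2^-1 :> R by rewrite -natr1; field.
by rewrite -mulrA rpredM ?rpredX ?rpred_nat ?gbin_half_int.
Qed.

Lemma natr_leq_exp2 k : k.+1%:R <= 2 ^+ k :> R.
Proof. by rewrite -natrX ler_nat ltn_expl. Qed.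

Lemma norm1_halfpow k (w W : R) : 1 <= W -> `|w| <= W ->
  norm1 (halfpow k w) <= (8 * W) ^+ k.
Proof.
move=> W_ge1 le_wW; rewrite (norm1E (size_poly _ _)).
have le_h (h : 'I_k.+1) : `|(halfpow k w)`_h| <= (4 * W) ^+ k.
  rewrite coef_poly ltn_ord normrM normrX exprMn; apply: ler_pM; rewrite ?exprn_ge0 //.
    have le_r : `|k%:R + 2^-1| <= k.+1%:R :> R.
      by rewrite -[k.+1%:R]natr1 ger0_norm ?addr_ge0 ?invr_ge0 // lerD2l; lra.
    apply: le_trans (gbin_bound h le_r) _.
    have -> : 4 ^+ k = (2 ^ (k + k))%:R :> R.
      by rewrite natrX exprD -exprMn; congr (_ ^+ _); ring.
    rewrite ler_nat (leq_trans (leq_bin_exp2 _ _)) // leq_exp2l //.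
    by rewrite leq_add2l -ltnS.
  apply: (@le_trans _ _ (W ^+ (k - h))); first by rewrite lerXn2r ?nnegrE // (le_trans ler01).
  by apply: ler_weXn2l; rewrite // leq_subr.
rewrite (le_trans (ler_sum _ (fun i _ => le_h i))) // sumr_const card_ord.
have -> : 8 * W = 2 * (4 * W) by ring.
rewrite [leRHS]exprMn -[_ *+ k.+1]mulr_natl ler_wpM2r ?natr_leq_exp2 //.
by rewrite exprn_ge0 // mulr_ge0 // (le_trans ler01).
Qed.

(** The range of [m] covers both the exponents [e < #|I|] of the forms and the exponents
    [#|I| * k + e] reached in the Taylor remainder. *)
Lemma norm1_monomial_locinv : exists2 C : R, 1 <= C & forall k i m,
  (m <= #|I| * k.+1)%N -> norm1 (('X + (a i)%:P) ^+ m * locinv a k i) <= C ^+ k.+1.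
Proof.
have [C C_ge1 leC] := norm1_locinv a_int a_inj.
pose A := \sum_i (1 + `|a i|).
have leA i : 1 + `|a i| <= 1 + A.
  rewrite /A (bigD1 i) //=; set S := \sum_(_ | _) _.
  have : 0 <= S by apply: sumr_ge0 => l _; rewrite addr_ge0.
  by move: (normr_ge0 (a i)); lra.
have A_ge1 : 1 <= 1 + A by rewrite lerDl sumr_ge0 // => l _; rewrite addr_ge0.
exists ((1 + A) ^+ #|I| * C); first by rewrite mulr_ege1 // exprn_ege1.
move=> k i m le_m; rewrite (le_trans (norm1M _ _)) // exprMn ler_pM ?norm1_ge0 //.
rewrite (le_trans (norm1X _ _)) // norm1_XaddC -exprM.
apply: le_trans (ler_weXn2l A_ge1 le_m).
by rewrite lerXn2r ?nnegrE ?(le_trans ler01 A_ge1) // addr_ge0.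
Qed.

Lemma padeform_bound : exists2 C : R, 1 <= C & forall k X i e, (e < #|I|)%N ->
  (forall j, `|a j| <= X) -> 1 <= X -> `|padeform a k X i 'X^e| <= C ^+ k.+1 * X ^+ k.
Proof.
have [C C_ge1 leC] := norm1_monomial_locinv.
exists (16 * C); first by rewrite mulr_ege1 // ler1n.
move=> k X i e lt_e le_aX X_ge1; rewrite /padeform comp_Xn_poly.
apply: le_trans (coef_norm1 _ _) _; apply: le_trans (norm1M _ _) _.
have le_w : `|X + a i| <= 2 * X.
  by rewrite (le_trans (ler_normD _ _)) // ger0_norm ?(le_trans ler01) // mulr2n mulrDl mul1r lerD2l.
have := norm1_halfpow k (W := 2 * X) _ le_w; rewrite mulr_ege1 ?ler1n // => /(_ isT) le_f.
have le_e : (e <= #|I| * k.+1)%N by rewrite (leq_trans (ltnW lt_e)) // mulnS leq_addr.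
apply: le_trans (ler_pM (norm1_ge0 _) (norm1_ge0 _) le_f (leC _ i _ le_e)) _.
have -> : 8 * (2 * X) = 16 * X by ring.
rewrite mulrC [16 * C]mulrC !exprMn -!mulrA ler_wpM2l ?ler_wpM2r ?ler_weXn2l ?ler1n //.
  by rewrite exprn_ge0 // (le_trans ler01).
by rewrite exprn_ge0 // (le_trans ler01).
Qed.

End PadeformSize.

(** * Taylor estimate and smallness of the Pade sums *)

Section TaylorBound.
Variable R : realType.

Lemma is_derive_ge0_le (f df : R -> R) (z s : R) :
  (forall t : R, 0 <= t <= z -> is_derive t (1 : R) f (df t)) ->
  (forall t : R, 0 <= t <= z -> 0 <= df t) -> 0 <= s <= z -> f 0 <= f s.
Proof.
move=> fdf df_ge0 /andP[s_ge0 le_sz].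
have sub (t : R) : t \in `[0, s] -> 0 <= t <= z.
  by rewrite in_itv /= => /andP[-> /le_trans->].
have cf : {within `[0, s]%classic, continuous f}.
  by apply: derivable_within_continuous => t /sub /fdf [].
have [t ts|c /sub c_z E] := MVT_segment (df := df) s_ge0 _ cf.
  by apply: fdf; apply: sub; apply: subset_itv_oo_cc ts.
by rewrite -subr_ge0 E subr0 mulr_ge0 // df_ge0.
Qed.

(** [F j] plays the role of the [j]-th derivative. The bound is integrated [M] times from 0: at each
    stage [G + F j] and [G - F j] are nondecreasing, where [G] is a primitive of the previous
    bound. *)
Lemma taylor_bound (F : nat -> R -> R) (z : R) M (B : R) :
  (forall j (t : R), (j < M)%N -> 0 <= t <= z -> is_derive t (1 : R) (F j) (F j.+1 t)) ->
  (forall j, (j < M)%N -> F j 0 = 0) -> (forall t : R, 0 <= t <= z -> `|F M t| <= B) ->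
  forall s : R, 0 <= s <= z -> `|F 0%N s| <= B * s ^+ M / M`!%:R.
Proof.
move=> dF F0 FM.
suff H m (s : R) : (m <= M)%N -> 0 <= s <= z -> `|F (M - m)%N s| <= B * s ^+ m / m`!%:R.
  by move=> s sz; have := H M s (leqnn _) sz; rewrite subnn.
elim: m s => [|m IHm] s le_mM sz; first by rewrite subn0 expr0 fact0 divr1 mulr1 FM.
have E : (M - m = (M - m.+1).+1)%N by lia.
rewrite E in IHm.
have lt_j : (M - m.+1 < M)%N by lia.
move: (M - m.+1)%N lt_j IHm => j lt_j IHm {E}.
pose G (t : R) := (B / m.+1`!%:R) * t ^+ m.+1.
have dG (t : R) : is_derive t (1 : R) G (B * t ^+ m / m`!%:R).
  have -> : G = (B / m.+1`!%:R) \*: ((@id R) ^+ m.+1).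
    by apply/funext => u; rewrite /G /= exprfctE.
  apply: is_derive_eq => /=; rewrite factS natrM.
  have f0 n : (n`!%:R : R) != 0 by rewrite pnatr_eq0 -lt0n fact_gt0.
  have n0 : (m.+1%:R : R) != 0 by rewrite pnatr_eq0.
  rewrite -![_ *: _]/(_ * _); field.
  by rewrite f0 nat1r n0.
have G0 : G 0 = 0 by rewrite /G expr0n mulr0.
have -> : B * s ^+ m.+1 / m.+1`!%:R = G s by rewrite /G mulrAC.
have bnd (t : R) : 0 <= t <= z -> - (B * t ^+ m / m`!%:R) <= F j.+1 t <= B * t ^+ m / m`!%:R.
  by move=> /IHm -/(_ (ltnW le_mM)); rewrite ler_norml.
rewrite ler_norml; apply/andP; split.
  suff: G 0 + F j 0 <= G s + F j s by rewrite G0 F0 // addr0; lra.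
  apply: (@is_derive_ge0_le (fun t => G t + F j t) (fun t => B * t ^+ m / m`!%:R + F j.+1 t)
    z s) => // t tz.
    by apply: (is_deriveD (f := G) (g := F j)); exact: dF.
  by have := bnd t tz; lra.
suff: G 0 - F j 0 <= G s - F j s by rewrite G0 F0 // subr0; lra.
apply: (@is_derive_ge0_le (fun t => G t - F j t) (fun t => B * t ^+ m / m`!%:R - F j.+1 t)
  z s) => // t tz.
  by apply: (is_deriveB (f := G) (g := F j)); exact: dF.
by have := bnd t tz; lra.
Qed.

End TaylorBound.

Section FractionalForm.
Variable R : realType.
Implicit Types (r c s : R) (G : {poly R}).

(* Coefficient of ['X^k] in [G (1 + c s + s 'X)^r]. *)
Definition fracform k r c G s :=
  \sum_(h < k.+1) gbin r h * s ^+ h * (1 + c * s) `^ (r - h%:R) * G`_(k - h).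

(** The derivative of [(1 + s (c + 'X))^r] in [s] is [r (c + 'X) (1 + s (c + 'X))^(r - 1)]. *)
Lemma is_derive_fracform k r c G s : 0 < 1 + c * s ->
  is_derive s (1 : R) (fracform k r c G)
    (r * fracform k (r - 1) c (('X + c%:P) * G) s).
Proof.
move=> cs_gt0.
pose D h := gbin r h * (h%:R * s ^+ h.-1 * (1 + c * s) `^ (r - h%:R) +
   s ^+ h * ((r - h%:R) * c * (1 + c * s) `^ (r - 1 - h%:R))) * G`_(k - h).
have dterm h : is_derive s (1 : R)
    (fun s => gbin r h * s ^+ h * (1 + c * s) `^ (r - h%:R) * G`_(k - h)) (D h).
  have dlin : is_derive s (1 : R) (fun s => 1 + c * s) c.
    have -> : (fun s => 1 + c * s) = cst 1 + c \*: @id R by apply/funext.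
    by apply: is_derive_eq; rewrite add0r -[LHS]/(c * 1) mulr1.
  have dpow := @is_derive1_comp _ (fun x : R => x `^ (r - h%:R)) (fun s => 1 + c * s) s _ _
    (@is_derive1_powR R (r - h%:R) _ cs_gt0) dlin.
  have -> : (fun s => gbin r h * s ^+ h * (1 + c * s) `^ (r - h%:R) * G`_(k - h)) =
     (gbin r h * G`_(k - h)) \*: ((@id R) ^+ h * ((fun x : R => x `^ (r - h%:R)) \o (fun s => 1 + c * s))).
    apply/funext => t.
    transitivity ((gbin r h * G`_(k - h)) * (t ^+ h * (1 + c * t) `^ (r - h%:R))); first by ring.
    by rewrite exprfctE.
  apply: is_derive_eq; rewrite /D exprfctE /= -![_ *: _]/(_ * _) -(addrAC r) mulr1; ring.
have dsum := is_derive_sum (fun h : 'I_k.+1 => dterm h).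
apply: is_derive_eq.
  have -> : fracform k r c G = \sum_(h < k.+1)
      (fun s => gbin r h * s ^+ h * (1 + c * s) `^ (r - h%:R) * G`_(k - h)).
    by apply/funext => t; rewrite fct_sumE.
  exact: dsum.
have -> : \sum_(h < k.+1) D h =
  \sum_(h < k.+1) gbin r h * (h%:R * s ^+ h.-1 * (1 + c * s) `^ (r - h%:R)) * G`_(k - h) +
  \sum_(h < k.+1) gbin r h * (s ^+ h * ((r - h%:R) * c * (1 + c * s) `^ (r - 1 - h%:R))) * G`_(k - h).
  by rewrite -big_split; apply: eq_bigr => h _; rewrite /D /=; ring.
rewrite /fracform mulr_sumr.
transitivity (\sum_(h < k.+1)
    (h.+1%:R * gbin r h.+1 * s ^+ h * (1 + c * s) `^ (r - 1 - h%:R) *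
       (if (k - h == 0)%N then 0 else G`_(k - h).-1) +
     (r - h%:R) * gbin r h * s ^+ h * (1 + c * s) `^ (r - 1 - h%:R) * (c * G`_(k - h)))); last first.
  apply: eq_bigr => h _; rewrite [('X + _) * _]mulrDl coefD coefCM coefXM -gbinS -gbin_pred; ring.
rewrite big_split /=; congr (_ + _); last first.
  by apply: eq_bigr => h _; ring.
(* The sums match after a shift of [h] by 1: the term [h = 0] on the left vanishes through its
   factor [h], the term [h = k] on the right because ['X * G] has no constant term. *)
rewrite big_ord_recl big_ord_recr /= mul0r mul0r mulr0 mul0r add0r subnn mulr0 addr0.
apply: eq_bigr => h _; rewrite /bump /= add1n subn_eq0 leqNgt ltn_ord /= -subnS.
have -> : r - h.+1%:R = r - 1 - h%:R by rewrite -natr1; ring.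
by ring.
Qed.
End FractionalForm.

Section FracformBound.
Variable R : realType.
Implicit Types (r c s t y : R) (G : {poly R}).

Lemma powR_bound y t m : 2^-1 <= y <= 2 -> `|t| <= m%:R -> y `^ t <= 2 ^+ m.
Proof.
have pos u v : 0 <= u <= 2 -> 0 <= v <= m%:R -> u `^ v <= 2 ^+ m.
  move=> /andP[u_ge0 le_u] /andP[v_ge0 le_v].
  rewrite -powR_mulrn // (le_trans (ge0_ler_powR v_ge0 _ _ le_u)) ?nnegrE //.
  by rewrite ler_powR // ler1n.
move=> /andP[y_ge y_le]; have y_gt0 : 0 < y by apply: lt_le_trans y_ge; rewrite invr_gt0.
have [t_ge0|t_lt0] := leP 0 t.
  by rewrite ger0_norm // => le_t; rewrite pos ?t_ge0 ?(ltW y_gt0).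
rewrite ltr0_norm // => le_t.
have -> : y `^ t = y^-1 `^ (- t).
  have E : y `^ (- t) * y^-1 `^ (- t) = 1.
    by rewrite -powRM ?invr_ge0 ?(ltW y_gt0) // mulfV ?gt_eqF // powR1.
  by rewrite -[t in LHS]opprK [LHS]powRN -[LHS]mulr1 -E mulKf // gt_eqF ?powR_gt0.
rewrite pos ?oppr_ge0 ?(ltW t_lt0) // invr_ge0 (ltW y_gt0) /=.
by rewrite -[leRHS]invrK lef_pV2 ?posrE ?invr_gt0.
Qed.

Lemma fracform_bound m k r c G s : `|r| <= m.+1%:R -> 0 <= s <= 1 ->
  2^-1 <= 1 + c * s <= 2 ->
  `|fracform k r c G s| <= 2 ^+ (m.*2.+1 + 3 * k) * norm1 G.
Proof.
move=> le_r /andP[s_ge0 s_le1] cs; rewrite /fracform (le_trans (ler_norm_sum _ _ _)) //.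
have le_h (h : 'I_k.+1) : `|gbin r h * s ^+ h * (1 + c * s) `^ (r - h%:R) * G`_(k - h)| <=
    2 ^+ (m + k) * 2 ^+ (m.+1 + k) * norm1 G.
  have le_hk : (h <= k)%N by rewrite -ltnS.
  have le_g : `|gbin r h| <= 2 ^+ (m + k).
    rewrite (le_trans (gbin_bound h le_r)) // -natrX ler_nat.
    by rewrite (leq_trans (leq_bin_exp2 _ _)) // leq_exp2l // leq_add2l.
  have le_s : `|s ^+ h| <= 1 by rewrite normrX ger0_norm // exprn_ile1.
  have le_p : `|(1 + c * s) `^ (r - h%:R)| <= 2 ^+ (m.+1 + k).
    rewrite ger0_norm ?powR_ge0 // powR_bound // (le_trans (ler_normB _ _)) //.
    by rewrite normr_nat natrD lerD // ler_nat.
  rewrite 3!normrM -[2 ^+ (m + k)]mulr1.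
  apply: ler_pM; [by rewrite !mulr_ge0|by []| |exact: coef_norm1].
  by apply: ler_pM; rewrite ?mulr_ge0 //; apply: ler_pM.
rewrite (le_trans (ler_sum _ (fun i _ => le_h i))) // sumr_const card_ord.
rewrite -[_ *+ k.+1]mulr_natl mulrA ler_wpM2r ?norm1_ge0 //.
have -> : (m.*2.+1 + 3 * k = k + (m + k + (m.+1 + k)))%N by lia.
by rewrite !exprD ler_wpM2r ?natr_leq_exp2 // !mulr_ge0 ?exprn_ge0.
Qed.

(** At [s = 1/X] the base is [(X + c + x) / X]. The factor [(X + c)^(1/2)] left out of [halfpow],
    divided by [X^(1/2)], is the square root on the right. *)
Lemma fracform_inv k c G X : 0 < X -> 0 < X + c ->
  fracform k (k%:R + 2^-1) c G X^-1 =
  X ^- k * (Num.sqrt (1 + c / X) * (halfpow k (X + c) * G)`_k).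
Proof.
move=> X_gt0 Xc_gt0; rewrite coefM !mulr_sumr; apply: eq_bigr => h _.
have le_hk : (h <= k)%N by rewrite -ltnS.
have yE : 1 + c / X = (X + c) / X by rewrite mulrDl divff ?gt_eqF.
have y_gt0 : 0 < 1 + c / X by rewrite yE divr_gt0.
have -> : k%:R + 2^-1 - h%:R = (k - h)%:R + 2^-1 :> R by rewrite natrB //; ring.
have -> : (1 + c / X) `^ ((k - h)%:R + 2^-1) = (1 + c / X) ^+ (k - h) * Num.sqrt (1 + c / X).
  rewrite powRD; last by rewrite (gt_eqF y_gt0) implybT.
  by rewrite powR_mulrn ?(ltW y_gt0) // powR12_sqrt // ltW.
have XE : X ^+ k = X ^+ (k - h) * X ^+ h by rewrite -exprD subnK.
by rewrite coef_poly ltn_ord {1}yE expr_div_n exprVn XE invfM; ring.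
Qed.

End FracformBound.

Section Smallness.
Variables (R : realType) (n : nat) (a : 'I_n -> R).
Hypotheses (a_int : forall i, a i \is a Num.int) (a_inj : injective a).

Lemma sum_fracform0 k r (G : 'I_n -> {poly R}) :
  \sum_i fracform k r (a i) (G i) 0 = \sum_i (G i)`_k.
Proof.
apply: eq_bigr => i _; rewrite /fracform big_ord_recl big1 => [|h _].
  by rewrite gbin0 expr0 mulr0 !addr0 powR1 !mul1r subn0.
by rewrite expr0n /= mulr0 !mul0r.
Qed.

(** The sum is [X ^+ k] times a function of [s = 1/X] whose derivatives of order below [n * k] at 0
    are multiples of vanishing sums of residues; [taylor_bound] then applies. *)
Lemma pade_small : exists C A : R, [/\ 1 <= C, 1 <= A &
  forall k X e, (e < n)%N -> A <= X ->
    `|\sum_i Num.sqrt (1 + a i / X) * padeform a k X i 'X^e| <=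
      C ^+ k.+1 * (X ^+ k / X ^+ (n * k))].
Proof.
have [C C_ge1 leC] := norm1_monomial_locinv a_int a_inj; rewrite card_ord in leC.
pose S := \sum_i `|a i|.
have leS i : `|a i| <= S by rewrite /S (bigD1 i) //= lerDl sumr_ge0.
have S_ge0 : 0 <= S by exact: sumr_ge0.
(* The second witness keeps [1 + a i * s] between 1/2 and 2 for [0 <= s <= X^-1]; in the first,
   [3 * n + 5] collects the powers of 2 from [gbin_bound] and [fracform_bound]. *)
exists (n%:R * (2 ^+ (3 * n + 5) * C) + 1), (2 * (1 + S)); split.
- by rewrite lerDr mulr_ge0 // mulr_ge0 ?exprn_ge0 // (le_trans ler01).
- by rewrite mulr_ege1 ?ler1n // lerDl.
move=> k X e lt_en le_X; have X_gt0 : 0 < X by apply: lt_le_trans le_X; lra.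
set r := k%:R + 2^-1 : R.
pose G j i := ('X + (a i)%:P) ^+ j * locinv a k i.
(* The [j]-th derivative of [F 0]: each differentiation lowers the exponent by 1 and multiplies [G]
   by ['X + (a i)%:P]. *)
pose F j s := (\prod_(l < j) (r - l%:R)) *
  \sum_i fracform k (r - j%:R) (a i) (G (j + e)%N i) s.
have n_gt0 : (0 < n)%N by case: (n) lt_en.
have range s i : 0 <= s <= X^-1 -> [/\ 0 <= s <= 1 & 2^-1 <= 1 + a i * s <= 2].
  move=> /andP[s_ge0 le_s].
  have le_sX : s * (2 * (1 + S)) <= 1.
    by rewrite (le_trans (ler_wpM2l s_ge0 le_X)) // -ler_pdivlMr // div1r.
  have le_sS : 0 <= s * S by rewrite mulr_ge0.
  have : `|a i * s| <= S * s by rewrite normrM (ger0_norm s_ge0) ler_wpM2r.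
  rewrite ler_norml => /andP[lo hi]; split; apply/andP; split=> //; lra.
have dF j t : (j < n * k)%N -> 0 <= t <= X^-1 -> is_derive t (1 : R) (F j) (F j.+1 t).
  move=> lt_j t_rng.
  have dfrac i : is_derive t (1 : R) (fracform k (r - j%:R) (a i) (G (j + e)%N i))
      ((r - j%:R) * fracform k (r - j%:R - 1) (a i) (('X + (a i)%:P) * G (j + e)%N i) t).
    apply: is_derive_fracform; have [_ /andP[lo _]] := range t i t_rng.
    by apply: lt_le_trans lo; rewrite invr_gt0.
  have dsum := is_deriveZ (\prod_(l < j) (r - l%:R)) (is_derive_sum dfrac).
  have -> : F j = (\prod_(l < j) (r - l%:R)) \*:
      (\sum_i fracform k (r - j%:R) (a i) (G (j + e)%N i)).
    by apply/funext => u; rewrite /F /= fct_sumE.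
  apply: is_derive_eq; rewrite -[LHS]/(_ * _) /F big_ord_recr /= -mulrA -mulr_sumr.
  congr (_ * (_ * _)); apply: eq_bigr => i _.
  by rewrite /G mulrA -exprS -addSn -natr1 opprD addrA.
have F0 j : (j < n * k)%N -> F j 0 = 0.
  move=> lt_j; rewrite /F sum_fracform0 (_ : \sum_i _ = 0) ?mulr0 //.
  transitivity (\sum_i (('X^(j + e) \Po ('X + (a i)%:P)) * locinv a k i)`_k).
    by apply: eq_bigr => i _; rewrite /G comp_Xn_poly.
  by rewrite sum_residues // card_ord size_polyXn mulnS; clear -lt_j lt_en; lia.
have FM t : 0 <= t <= X^-1 -> `|F (n * k)%N t| <=
    `|\prod_(l < n * k) (r - l%:R)| * (n%:R * (2 ^+ ((n * k).*2.+1 + 3 * k) * C ^+ k.+1)).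
  move=> t_rng; rewrite /F normrM ler_wpM2l // (le_trans (ler_norm_sum _ _ _)) //.
  have le_i i : `|fracform k (r - (n * k)%:R) (a i) (G (n * k + e)%N i) t| <=
      2 ^+ ((n * k).*2.+1 + 3 * k) * C ^+ k.+1.
    have [t_01 y_rng] := range t i t_rng.
    have le_r : `|r - (n * k)%:R| <= (n * k).+1%:R.
      rewrite ler_norml /r -[(n * k).+1%:R]natr1.
      have : (k%:R : R) <= (n * k)%:R by rewrite ler_nat leq_pmull.
      have : (0 : R) <= k%:R by [].
      by move=> *; apply/andP; split; lra.
    apply: le_trans (fracform_bound k _ le_r t_01 y_rng) _.
    by rewrite ler_wpM2l ?exprn_ge0 // leC // mulnS; clear -lt_en; lia.
  by rewrite (le_trans (ler_sum _ (fun i _ => le_i i))) // sumr_const card_ord mulr_natl.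
have sX : 0 <= X^-1 <= X^-1 by rewrite lexx invr_ge0 ltW.
have Xai_gt0 i : 0 < X + a i by have := leS i; rewrite ler_norml => /andP[lo _]; lra.
have := taylor_bound dF F0 FM sX.
have -> : F 0%N X^-1 = X ^- k * \sum_i Num.sqrt (1 + a i / X) * padeform a k X i 'X^e.
  rewrite /F big_ord0 mul1r subr0 mulr_sumr; apply: eq_bigr => i _.
  by rewrite fracform_inv // /padeform comp_Xn_poly /G add0n.
have Xk_gt0 m : 0 < X ^+ m by rewrite exprn_gt0.
rewrite normrM gtr0_norm ?invr_gt0 // ler_pdivrMl // => /le_trans; apply.
set P := `|\prod_(_ < _) _|; set Q := 2 ^+ _ * C ^+ _.
have -> : X ^+ k * (P * (n%:R * Q) * X^-1 ^+ (n * k) / (n * k)`!%:R) =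
    (P / (n * k)`!%:R * (n%:R * Q)) * (X ^+ k / X ^+ (n * k)) by rewrite exprVn; ring.
rewrite ler_pM2r ?divr_gt0 //.
(* The Taylor factorial turns the product of exponents into a binomial coefficient, of exponential
   size only. *)
have -> : P / (n * k)`!%:R = `|gbin r (n * k)| by rewrite /gbin normrM normfV normr_nat.
have r_ge0 : 0 <= r by rewrite addr_ge0 // invr_ge0.
have le_r : `|r| <= k.+1%:R by rewrite ger0_norm // -[k.+1%:R]natr1 /r lerD2l; lra.
have le_g : `|gbin r (n * k)| <= 2 ^+ (k + n * k).
  by rewrite (le_trans (gbin_bound _ le_r)) // -natrX ler_nat leq_bin_exp2.
have Q_ge0 : 0 <= n%:R * Q by rewrite !mulr_ge0 ?exprn_ge0 // (le_trans ler01).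
apply: le_trans (ler_wpM2r Q_ge0 le_g) _.
have B_ge0 : 0 <= n%:R * (2 ^+ (3 * n + 5) * C).
  by rewrite !mulr_ge0 ?exprn_ge0 // (le_trans ler01).
apply: (@le_trans _ _ ((n%:R * (2 ^+ (3 * n + 5) * C)) ^+ k.+1)); last first.
  by rewrite lerXn2r ?nnegrE ?addr_ge0 // lerDl.
have -> : 2 ^+ (k + n * k) * (n%:R * Q) =
    n%:R * (2 ^+ (k + n * k + ((n * k).*2.+1 + 3 * k)) * C ^+ k.+1).
  by rewrite /Q [2 ^+ (_ + _ + (_ + _))]exprD; ring.
have C_ge0 m : 0 <= C ^+ m by rewrite exprn_ge0 // (le_trans ler01).
rewrite 2!exprMn -exprM; apply: ler_pM; rewrite ?mulr_ge0 ?C_ge0 ?exprn_ge0 //.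
  by rewrite -natrX ler_nat expnS leq_pmulr // expn_gt0 n_gt0.
by rewrite ler_wpM2r // ler_weXn2l ?ler1n //; clear; nia.
Qed.
End Smallness.

(** * The gap principle *)

Section ProductSquares.
Variable R : realType.

Lemma expn_sandwich (x y : R) : 2 <= x -> 1 <= y -> exists k, x ^+ (3 * k) <= y < x ^+ (3 * k.+1).
Proof.
move=> x_ge2 y_ge1; have x_ge1 : 1 <= x by lra.
have [m lt_ym] : exists m, y < x ^+ (3 * m).
  exists (Num.truncn y).+1; apply: lt_le_trans (truncnS_gt y) _.
  apply: (@le_trans _ _ (2 ^+ (Num.truncn y).+1)).
    by rewrite -natrX ler_nat ltnW // ltn_expl.
  apply: (@le_trans _ _ (x ^+ (Num.truncn y).+1)); first by rewrite lerXn2r ?nnegrE //; lra.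
  by rewrite ler_weXn2l //; lia.
have exm : exists m, y < x ^+ (3 * m) by exists m.
case: (ex_minnP exm) => [[|k] lt_k min_k]; first by rewrite muln0 expr0 in lt_k; lra.
exists k; rewrite lt_k andbT leNgt; apply/negP => /min_k; rewrite ltnn //.
Qed.

Lemma sqrt_sub1 (x : R) : `|x| <= 1 -> `|Num.sqrt (1 + x) - 1| <= `|x|.
Proof.
rewrite ler_norml => /andP[x_ge x_le].
have x1 : 0 <= 1 + x by lra.
set u := Num.sqrt (1 + x); have u_ge0 : 0 <= u := sqrtr_ge0 _.
have uE : u ^+ 2 = 1 + x by rewrite sqr_sqrtr.
have -> : x = (u - 1) * (u + 1) by rewrite -subr_sqr uE expr1n addrAC subrr add0r.
rewrite normrM ler_peMr // ger0_norm; lra.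
Qed.

Section Approximation.
Variables (n : nat) (a : 'I_n -> R).

(** Write [y i = sqrt (X Z) u_i v_i]. Replacing [v_i] by 1 leaves the small Pade sum, and costs at
    most [2 (S / Z) P] per term since [u_i <= 2] and [|v_i - 1| <= S / Z]. *)
Lemma bilinear_bound (p y : 'I_n -> R) X Z S L P :
  (forall i, `|a i| <= S) -> 1 <= X -> S <= X -> X <= Z ->
  (forall i, 0 <= y i) -> (forall i, y i ^+ 2 = (X + a i) * (Z + a i)) ->
  `|\sum_i Num.sqrt (1 + a i / X) * p i| <= L -> (forall i, `|p i| <= P) ->
  `|\sum_i y i * p i| <= Num.sqrt (X * Z) * (L + n%:R * (2 * (S / Z) * P)).
Proof.
move=> leS X_ge1 le_SX le_XZ y_ge0 yE leL leP.
have X_gt0 : 0 < X by lra.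
have Z_gt0 : 0 < Z by lra.
pose u i := Num.sqrt (1 + a i / X); pose v i := Num.sqrt (1 + a i / Z).
have a_X i : `|a i / X| <= 1.
  by rewrite normrM normfV (gtr0_norm X_gt0) ler_pdivrMr // mul1r (le_trans (leS i)).
have a_Z i : `|a i / Z| <= S / Z by rewrite normrM normfV (gtr0_norm Z_gt0) ler_pM2r ?invr_gt0.
have S_Z : S / Z <= 1 by rewrite ler_pdivrMr // mul1r (le_trans le_SX).
have yuv i : y i = Num.sqrt (X * Z) * (u i * v i).
  rewrite -[y i]ger0_norm // -sqrtr_sqr yE /u /v.
  have aX0 : 0 <= 1 + a i / X by have := a_X i; rewrite ler_norml => /andP[]; lra.
  rewrite -sqrtrM // -sqrtrM ?mulr_ge0 ?ltW //; congr Num.sqrt.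
  by field; rewrite !gt_eqF.
have -> : \sum_i y i * p i = Num.sqrt (X * Z) *
    (\sum_i u i * p i + \sum_i u i * (v i - 1) * p i).
  by rewrite -big_split mulr_sumr; apply: eq_bigr => i _; rewrite yuv /=; ring.
rewrite normrM (ger0_norm (sqrtr_ge0 _)) ler_wpM2l ?sqrtr_ge0 //.
rewrite (le_trans (ler_normD _ _)) // lerD // (le_trans (ler_norm_sum _ _ _)) //.
have le_i i : `|u i * (v i - 1) * p i| <= 2 * (S / Z) * P.
  rewrite 2!normrM; apply: ler_pM; rewrite ?mulr_ge0 //; apply: ler_pM => //.
    have := sqrt_sub1 (a_X i); rewrite -/(u i) ler_norml ger0_norm ?sqrtr_ge0 // => /andP[_].
    by have := a_X i; lra.
  by apply: le_trans (sqrt_sub1 (le_trans (a_Z i) S_Z)) (a_Z i).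
by rewrite (le_trans (ler_sum _ (fun i _ => le_i i))) // sumr_const card_ord -[leLHS]mulr_natl.
Qed.

End Approximation.

(** Each of the two terms is shown to be at most 1/2, the first strictly. After squaring,
    [Z < X^(3 k + 3)] handles the first and [Z >= X^(3 k)] the second. *)
Lemma final_size (D X Z q : R) k : (8 <= k)%N -> 1 <= D -> (4 * D ^+ 2) ^+ 3 <= X ->
  X ^+ (3 * k) <= Z < X ^+ (3 * k.+1) -> 0 <= q -> q ^+ 2 = X * Z ->
  q * (D ^+ k.+1 * (X ^+ k / X ^+ (3 * k)) + D ^+ k.+1 * X ^+ k / Z) < 1.
Proof.
move=> k_ge8 D_ge1 le_DX /andP[le_Z lt_Z] q_ge0 qE.
have D2_ge1 : 1 <= D ^+ 2 by rewrite exprn_ege1.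
have X_ge1 : 1 <= X.
  by apply: le_trans le_DX; rewrite exprn_ege1 //; lra.
have X_gt0 : 0 < X by lra.
have Z_gt0 : 0 < Z by apply: lt_le_trans le_Z; rewrite exprn_gt0.
set E := D ^+ k.+1; have E_gt0 : 0 < E by rewrite exprn_gt0 //; lra.
(* The cube in the hypothesis on [X] matters here: [k + 1 <= 3 (k - 4)] as [k >= 8]. *)
have E_small : 4 * E ^+ 2 <= X ^+ (k - 4).
  apply: (@le_trans _ _ (((4 * D ^+ 2) ^+ 3) ^+ (k - 4))); last first.
    by rewrite lerXn2r ?nnegrE ?exprn_ge0 //; lra.
  rewrite -exprM; apply: (@le_trans _ _ ((4 * D ^+ 2) ^+ k.+1)).
    have -> : E ^+ 2 = (D ^+ 2) ^+ k.+1 by rewrite /E -!exprM mulnC.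
    rewrite [leRHS]exprMn ler_wpM2r ?exprn_ge0 ?(le_trans ler01 D_ge1) //.
    by rewrite exprS ler_peMr // exprn_ege1 // ler1n.
  by apply: ler_weXn2l; [lra | clear -k_ge8; lia].
have XkE m j : (m <= j)%N -> X ^+ j = X ^+ (j - m) * X ^+ m.
  by move=> le_mj; rewrite -exprD subnK.
have sq_lt (x y : R) : 0 <= x -> 0 < y -> x ^+ 2 < y ^+ 2 -> x < y.
  by move=> *; rewrite -(@ltr_pXn2r _ 2) ?nnegrE // ltW.
have sq_le (x y : R) : 0 <= x -> 0 < y -> x ^+ 2 <= y ^+ 2 -> x <= y.
  by move=> *; rewrite -(@ler_pXn2r _ 2) ?nnegrE // ltW.
have Xk_gt0 m : 0 < X ^+ m by rewrite exprn_gt0.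
have t1 : 2 * E * q < X ^+ (2 * k).
  apply: sq_lt => //; first by rewrite !mulr_ge0 // ltW.
  have -> : (2 * E * q) ^+ 2 = 4 * E ^+ 2 * X * Z by rewrite 2!exprMn qE; ring.
  apply: (@lt_le_trans _ _ (4 * E ^+ 2 * X * X ^+ (3 * k.+1))).
    by rewrite ltr_pM2l // !mulr_gt0 // exprn_gt0.
  rewrite -[(X ^+ _) ^+ 2]exprM (XkE (3 * k.+1).+1 (2 * k * 2)%N); last by clear -k_ge8; lia.
  rewrite [X ^+ (_).+1]exprS mulrA ler_pM2r // ler_pM2r //.
  by rewrite (le_trans E_small) // ler_weXn2l //; clear -k_ge8; lia.
have t2 : 2 * E * q * X ^+ k <= Z.
  apply: sq_le => //; first by rewrite !mulr_ge0 // ltW.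
  have -> : (2 * E * q * X ^+ k) ^+ 2 = 4 * E ^+ 2 * (X * X ^+ (k * 2)) * Z.
    by rewrite 3!exprMn qE -[(X ^+ k) ^+ 2]exprM; ring.
  rewrite [Z ^+ 2]expr2 ler_pM2r // (le_trans _ le_Z) //.
  rewrite -exprS (XkE (k * 2).+1 (3 * k)%N); last by clear -k_ge8; lia.
  by rewrite ler_pM2r // (le_trans E_small) // ler_weXn2l //; clear -k_ge8; lia.
have -> : X ^+ k / X ^+ (3 * k) = (X ^+ (2 * k))^-1.
  have -> : (3 * k = 2 * k + k)%N by clear; lia.
  by rewrite exprD invfM mulrCA divff ?mulr1 // gt_eqF.
have u1 : 2 * E * q / X ^+ (2 * k) < 1 by rewrite ltr_pdivrMr // mul1r.
have u2 : 2 * E * q * X ^+ k / Z <= 1 by rewrite ler_pdivrMr // mul1r.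
have -> : q * (E * (X ^+ (2 * k))^-1 + E * X ^+ k / Z) =
  2^-1 * (2 * E * q / X ^+ (2 * k)) + 2^-1 * (2 * E * q * X ^+ k / Z) by field; rewrite !gt_eqF.
lra.
Qed.

End ProductSquares.

Section Gap.
Variable R : realType.

Lemma absorb_constant (B C D : R) k : 1 <= B -> 0 <= C -> 4 * (B * C) <= D ->
  4 ^+ k * B * C ^+ k.+1 <= D ^+ k.+1.
Proof.
move=> B_ge1 C_ge0 le_D; have B_ge0 : 0 <= B := le_trans ler01 B_ge1.
have BC_ge0 : 0 <= 4 * (B * C) by rewrite !mulr_ge0.
apply: (@le_trans _ _ ((4 * (B * C)) ^+ k.+1)); last first.
  by rewrite lerXn2r ?nnegrE ?(le_trans BC_ge0 le_D).
rewrite 2!exprMn mulrA ler_wpM2r ?exprn_ge0 //.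
apply: ler_pM; rewrite ?exprn_ge0 ?ler_weXn2l ?ler1n //.
by rewrite -[leLHS]expr1 ler_weXn2l.
Qed.

Theorem square_products_gap (a : 'I_3 -> R) :
  (forall i, a i \is a Num.int) -> injective a ->
  exists B : R, forall X Z, X \is a Num.int -> Z \is a Num.int -> B <= X -> X ^+ 24 <= Z ->
    ~ (forall i, exists2 y, y \is a Num.int & y ^+ 2 = (X + a i) * (Z + a i)).
Proof.
move=> a_int a_inj.
have [C1 [A1 [C1_ge1 A1_ge1 small]]] := pade_small a_int a_inj.
have [C2 C2_ge1 bnd] := padeform_bound a_int a_inj; rewrite card_ord in bnd.
pose S := 1 + \sum_i `|a i|.
have S_ge1 : 1 <= S by rewrite lerDl sumr_ge0.
have ltS i : `|a i| < S.
  rewrite /S (bigD1 i) //=; set T := \sum_(_ | _) _.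
  by have : 0 <= T by [apply: sumr_ge0]; lra.
have leS i : `|a i| <= S by exact: ltW.
(* [D ^+ k.+1] absorbs the denominator [4 ^+ k] and the factor [6 * S], which is [n * 2 * S] in
   [bilinear_bound] with [n = 3]. *)
pose D := 4 * (C1 + 6 * S * C2).
have SC2_ge1 : 1 <= S * C2 by rewrite mulr_ege1.
have D_ge1 : 1 <= D by rewrite /D -mulrA; lra.
have S6_ge1 : 1 <= 6 * S by lra.
have C2_ge0 : 0 <= C2 by lra.
have C1_ge0 : 0 <= C1 by lra.
have le_C1D : 4 * C1 <= D by rewrite /D -mulrA; lra.
have le_C2D : 4 * (6 * S * C2) <= D by rewrite /D; lra.
clearbody D.
(* The summands serve, in order, [pade_small], the positivity of [X + a i], [expn_sandwich] and
   [final_size]. *)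
exists (A1 + S + 2 + (4 * D ^+ 2) ^+ 3) => X Z X_int Z_int le_BX le_XZ sq.
have D0 : 0 <= (4 * D ^+ 2) ^+ 3 by rewrite exprn_ge0 // mulr_ge0 // sqr_ge0.
have le_A1X : A1 <= X by lra.
have X_ge2 : 2 <= X by lra.
have X_ge1 : 1 <= X by lra.
have le_SX : S <= X by lra.
have le_DX : (4 * D ^+ 2) ^+ 3 <= X by lra.
have le_X_Z : X <= Z by apply: le_trans le_XZ; rewrite -[leLHS]expr1 ler_weXn2l.
have [k /andP[le_kZ lt_Zk]] := expn_sandwich X_ge2 (le_trans X_ge1 le_X_Z).
(* The exponent 24 enters here: [X^24 <= Z < X^(3 k + 3)] forces [k > 7]. *)
have k_ge8 : (8 <= k)%N.
  have := le_lt_trans le_XZ lt_Zk; rewrite ltr_eXn2l; last by lra.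
  by clear; lia.
have Xa_gt0 i : 0 < X + a i by have := ltS i; rewrite ltr_norml => /andP[lo _]; lra.
have Za_gt0 i : 0 < Z + a i by have := Xa_gt0 i; lra.
pose y i := Num.sqrt ((X + a i) * (Z + a i)).
have y_gt0 i : 0 < y i by rewrite sqrtr_gt0 mulr_gt0.
have yE i : y i ^+ 2 = (X + a i) * (Z + a i) by rewrite sqr_sqrtr // ltW // mulr_gt0.
have y_int i : y i \is a Num.int.
  by have [t t_int tE] := sq i; rewrite /y -tE sqrtr_sqr; exact/intr_nat/natr_norm_int.
have [e lt_e3 N_neq0] : exists2 e, (e < 3)%N & \sum_i y i * padeform a k X i 'X^e != 0.
  have [/forallP N0|/forallPn[e N_neq0]] :=
      boolP [forall e : 'I_3, \sum_i y i * padeform a k X i 'X^e == 0]; last by exists e.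
  have := @pade_nonvanishing _ _ _ a_inj k X y _ _ ord0.
  have w_neq0 i : X + a i != 0 by rewrite gt_eqF.
  move=> /(_ w_neq0) y0; have /eqP := y_gt0 ord0; rewrite y0 ?ltxx // => j.
  by rewrite card_ord => lt_j; exact/eqP/(N0 (Ordinal lt_j)).
have N_int : 4 ^+ k * \sum_i y i * padeform a k X i 'X^e \is a Num.int.
  rewrite mulr_sumr; apply: rpred_sum => i _; rewrite mulrCA rpredM //.
  exact: padeform_int.
have N_ge1 : 1 <= `|4 ^+ k * \sum_i y i * padeform a k X i 'X^e|.
  by rewrite norm_intr_ge1 // mulf_neq0 // expf_neq0 // pnatr_eq0.
pose q := Num.sqrt (X * Z).
have X_ge0 : 0 <= X := le_trans ler01 X_ge1.
have qE : q ^+ 2 = X * Z by rewrite sqr_sqrtr // mulr_ge0 // (le_trans X_ge0).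
have le_aX i : `|a i| <= X by rewrite (le_trans (leS i)).
have le_N := bilinear_bound leS X_ge1 le_SX le_X_Z (fun i => ltW (y_gt0 i)) yE
  (small k X e lt_e3 le_A1X) (fun i => bnd k X i e lt_e3 le_aX X_ge1).
have kZ : X ^+ (3 * k) <= Z < X ^+ (3 * k.+1) by rewrite le_kZ.
have := final_size k_ge8 D_ge1 le_DX kZ (sqrtr_ge0 _) qE.
rewrite ltNge => /negP[]; apply: le_trans N_ge1 _.
rewrite normrM (ger0_norm (exprn_ge0 _ _)) //.
apply: le_trans (ler_wpM2l (exprn_ge0 k (ler0n R 4)) le_N) _.
rewrite -/q mulrCA ler_wpM2l ?sqrtr_ge0 // mulrDr.
have X_gt0 m : 0 < X ^+ m := exprn_gt0 m (lt_le_trans ltr01 X_ge1).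
have Z_gt0 : 0 < Z := lt_le_trans ltr01 (le_trans X_ge1 le_X_Z).
have le_C1 : 4 ^+ k * C1 ^+ k.+1 <= D ^+ k.+1.
  by rewrite -[4 ^+ k]mulr1; apply: absorb_constant; rewrite ?mul1r.
have le_C2 : 4 ^+ k * (6 * S) * C2 ^+ k.+1 <= D ^+ k.+1 by exact: absorb_constant.
apply: lerD.
  rewrite [leLHS]mulrA; apply: ler_wpM2r le_C1.
  by rewrite divr_ge0 // ltW.
have -> : 4 ^+ k * (3%:R * (2 * (S / Z) * (C2 ^+ k.+1 * X ^+ k))) =
   4 ^+ k * (6 * S) * C2 ^+ k.+1 * (X ^+ k / Z) by field; rewrite gt_eqF.
rewrite -[leRHS]mulrA; apply: ler_wpM2r le_C2.
by rewrite divr_ge0 // ltW.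
Qed.

End Gap.

(* Transfer of the gap principle to the integers *)
From Stdlib Require Import Reals.

Lemma IZR_int (z : Z) : (IZR z : Rdefinitions.R) \is a Num.int.
Proof.
have pos p : (IZR (Z.pos p) : Rdefinitions.R) \is a Num.int.
  by rewrite IZRposE INRE rpred_nat.
case: z => [|p|p]; [by rewrite R0E rpred0 | exact: pos |].
by rewrite -[Z.neg p]/(Z.opp (Z.pos p)) opp_IZR rpredN.
Qed.

Theorem square_products_gap_Z (a0 a1 a2 : Z) : a0 <> a1 -> a0 <> a2 -> a1 <> a2 ->
  exists B : Z, forall X W : Z, Z.le B X -> Z.le (Z.pow X 24) W ->
    (exists y, Z.mul y y = Z.mul (Z.add X a0) (Z.add W a0)) ->
    (exists y, Z.mul y y = Z.mul (Z.add X a1) (Z.add W a1)) ->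
    (exists y, Z.mul y y = Z.mul (Z.add X a2) (Z.add W a2)) -> False.
Proof.
move=> ne01 ne02 ne12.
pose a (i : 'I_3) : Rdefinitions.R := IZR (nth a0 [:: a0; a1; a2] i).
have a_int i : a i \is a Num.int by exact: IZR_int.
have a_inj : injective a.
  move=> i j /eq_IZR; case: i j => [[|[|[|//]]] ?] [[|[|[|//]]] ?] //= E;
    by [apply: val_inj | case: (ne01) | case: (ne02) | case: (ne12)].
have [B gap] := square_products_gap a_int a_inj.
exists (up B) => X W /IZR_le/RleP le_BX /IZR_le/RleP le_XW [y0 E0] [y1 E1] [y2 E2].
have {}le_BX : B <= IZR X.
  by apply: le_trans le_BX; apply/RleP/Rlt_le; have [] := archimed B.
have {}le_XW : (IZR X : Rdefinitions.R) ^+ 24 <= IZR W.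
  by rewrite -RpowE pow_IZR.
have sq y b : Z.mul y y = Z.mul (Z.add X b) (Z.add W b) ->
    exists2 t : Rdefinitions.R, t \is a Num.int & t ^+ 2 = (IZR X + IZR b) * (IZR W + IZR b).
  by move=> E; exists (IZR y); rewrite ?IZR_int // expr2 -RmultE -mult_IZR E mult_IZR !plus_IZR.
apply: (gap _ _ (IZR_int X) (IZR_int W) le_BX le_XW) => i; rewrite /a.
by case: i => [[|[|[|//]]] ?] /=; [exact: sq E0 | exact: sq E1 | exact: sq E2].
Qed.

End Pade.

(** * Boundedness of the solutions and finiteness *)

Lemma bounded_triples_finite (P : Z * Z * Z -> Prop) (M : Z) :
  (forall x y z, P (x, y, z) -> Z.abs x <= M /\ Z.abs y <= M /\ Z.abs z <= M) ->
  finite_set P.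
Proof.
intros bnd.
set (r := map (fun n => Z.of_nat n - M) (seq 0 (Z.to_nat (2 * M + 1)))).
assert (in_r : forall x, Z.abs x <= M -> In x r).
{ intros x Hx. apply in_map_iff. exists (Z.to_nat (x + M)). split; [lia|].
  apply in_seq. lia. }
exists (list_prod (list_prod r r) r). intros [[x y] z] Hp.
destruct (bnd x y z Hp) as (Hx & Hy & Hz).
apply in_prod; [apply in_prod|]; auto.
Qed.

Lemma conic_bound (p q d x y N : Z) :
  q <> 0 -> p * x ^ 2 + q * y ^ 2 = d -> Z.abs x <= N -> 
  Z.abs y <= Z.abs d + Z.abs p * N ^ 2.
Proof.
intros Hq E Hx.
assert (x ^ 2 <= N ^ 2) by nia.
assert (Z.abs (q * y ^ 2) <= Z.abs d + Z.abs p * N ^ 2).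
{ replace (q * y ^ 2) with (d - p * x ^ 2) by lia.
  assert (Z.abs (p * x ^ 2) <= Z.abs p * N ^ 2) by (rewrite Z.abs_mul; nia).
  lia. }
rewrite Z.abs_mul in H0.
assert (Z.abs y <= Z.abs (y ^ 2)) by (destruct (Z.eq_dec y 0); [subst; simpl; lia | nia]).
nia.
Qed.

(** With [X = (p m x)^2], the equations make [X - e] and [X - e'] fixed multiples of [y^2] and
    [z^2], so for two solutions the gap principle applies to the nodes [0], [- e], [- e']; [e] and
    [e'] differ since [d * m - d' * p] is nonzero. *)
Lemma conic_pair_bounded (m p q d d' : Z) :
  m <> 0 -> p <> 0 -> q <> 0 -> d <> 0 -> d' <> 0 -> d * m - d' * p <> 0 ->
  exists N, forall x y z, p * x ^ 2 + q * y ^ 2 = d -> m * x ^ 2 + - q * z ^ 2 = d' ->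
  Z.abs x <= N /\ Z.abs y <= N /\ Z.abs z <= N.
Proof.
intros Hm Hp Hq Hd Hd' Hdd'.
assert (opp_neq0 : forall t, t <> 0 -> 0 <> - t) by (intros; lia).
assert (opp_neq : forall s t, s - t <> 0 -> - s <> - t) by (intros; lia).
assert (Hpm : p * m <> 0) by (apply Z.neq_mul_0; split; assumption).
set (e := d * p * (m * m)). set (e' := d' * m * (p * p)).
assert (He : 0 <> - e).
{ apply opp_neq0. unfold e. repeat (apply Z.neq_mul_0; split); assumption. }
assert (He' : 0 <> - e').
{ apply opp_neq0. unfold e'. repeat (apply Z.neq_mul_0; split); assumption. }
assert (Hee' : - e <> - e').
{ apply opp_neq. replace (e - e') with (p * m * (d * m - d' * p)) by (unfold e, e'; ring).
  apply Z.neq_mul_0; split; assumption. }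
destruct (@Pade.square_products_gap_Z 0 (- e) (- e') He He' Hee') as [B gap].
set (X := fun x => (p * m * x) ^ 2).
assert (Xy : forall x y, p * x ^ 2 + q * y ^ 2 = d -> X x + - e = - (p * m ^ 2 * q) * y ^ 2).
{ intros x y E. unfold X, e. rewrite <- E. ring. }
assert (Xz : forall x z, m * x ^ 2 + - q * z ^ 2 = d' -> X x + - e' = (m * p ^ 2 * q) * z ^ 2).
{ intros x z E. unfold X, e'. rewrite <- E. ring. }
assert (bound_X : exists M, forall x y z,
  p * x ^ 2 + q * y ^ 2 = d -> m * x ^ 2 + - q * z ^ 2 = d' -> X x <= M).
(* One solution [x0] with [X x0 >= B] bounds all the others by [X x0 ^ 24]; without such a solution
   [B] itself is a bound. This case distinction makes the bound ineffective. *)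
{ destruct (classic (exists x y z,
    p * x ^ 2 + q * y ^ 2 = d /\ m * x ^ 2 + - q * z ^ 2 = d' /\ B <= X x))
    as [(x0 & y0 & z0 & Ey0 & Ez0 & HB)|none].
  - exists (X x0 ^ 24). intros x y z Ey Ez.
    apply Z.le_ngt. intro Hgt.
    apply (gap (X x0) (X x)); [assumption | apply Z.lt_le_incl; assumption | | |].
    + exists ((p * m * x0) * (p * m * x)). unfold X. ring.
    + exists (p * m ^ 2 * q * y0 * y). rewrite (Xy _ y0), (Xy _ y) by assumption. ring.
    + exists (m * p ^ 2 * q * z0 * z). rewrite (Xz _ z0), (Xz _ z) by assumption. ring.
  - exists B. intros x y z Ey Ez. apply Z.le_ngt. intro Hgt.
    apply none. exists x, y, z. repeat split; try assumption. apply Z.lt_le_incl; assumption. }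
destruct bound_X as [M HM].
assert (Hx : forall x y z,
  p * x ^ 2 + q * y ^ 2 = d -> m * x ^ 2 + - q * z ^ 2 = d' -> Z.abs x <= Z.abs M).
{ intros x y z Ey Ez. specialize (HM x y z Ey Ez). unfold X in HM. clear - HM Hpm.
  rewrite Z.pow_mul_l in HM.
  assert (1 <= (p * m) ^ 2) by (generalize dependent (p * m); intros; nia).
  generalize dependent ((p * m) ^ 2). intros. nia. }
exists (Z.abs M + (Z.abs d + Z.abs p * Z.abs M ^ 2) + (Z.abs d' + Z.abs m * Z.abs M ^ 2)).
intros x y z Ey Ez. pose proof (Hx x y z Ey Ez) as Bx.
pose proof (conic_bound p q d x y _ Hq Ey Bx) as By.
assert (Hq' : - q <> 0) by (clear - Hq; lia).
pose proof (conic_bound m (- q) d' x z _ Hq' Ez Bx) as Bz.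
clear - Bx By Bz.
assert (0 <= Z.abs p * Z.abs M ^ 2) by nia. assert (0 <= Z.abs m * Z.abs M ^ 2) by nia.
lia.
Qed.

Theorem theorem6 (a1 b1 c1 d1 a2 b2 c2 d2 : Z) :
  minor2 a1 a2 b1 b2 <> 0 ->
  minor2 a1 a2 c1 c2 <> 0 ->
  minor2 a1 a2 d1 d2 <> 0 ->
  minor2 b1 b2 c1 c2 <> 0 ->
  minor2 b1 b2 d1 d2 <> 0 ->
  minor2 c1 c2 d1 d2 <> 0 ->
  finite_set (sol a1 b1 c1 d1 a2 b2 c2 d2).
Proof.
unfold minor2. intros Hab Hac Had Hbc Hbd Hcd.
(* These minors are the coefficients obtained by eliminating [z], respectively [y], from the
   system. *)
destruct (conic_pair_bounded (a1 * b2 - b1 * a2) (a1 * c2 - c1 * a2) (b1 * c2 - c1 * b2)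
  (d1 * c2 - c1 * d2) (d1 * b2 - b1 * d2)) as [N HN]; [assumption..|lia|lia| |].
(* A Plucker relation among the minors of the matrix. *)
- replace (_ - _) with ((b1 * c2 - c1 * b2) * (a1 * d2 - d1 * a2)) by ring.
  apply Z.neq_mul_0; split; assumption.
- apply (bounded_triples_finite _ N). intros x y z [E1 E2].
  apply HN; rewrite <- E1, <- E2; ring.
Qed.
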